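(* Let $v^{1/2}$ be the time-$\frac12$ map of the vector field $\dot z=\frac{z^{k+1}}{1+bz^k}$ for some $b$, and let $f$ be an antiholomorphic parabolic germ at $0\in\mathbb{C}$. If $f$ is of codimension $k$, of positive type if $k$ is even, and if $f$ has formal invariant $b$, then $f$ and $\sigma\circ v^{1/2}$ are formally conjugate.
   Context: $\sigma(z)=\bar z$. A germ of antiholomorphic diffeomorphism $f:(\mathbb{C},0)\to(\mathbb{C},0)$ is parabolic if $0$ is an isolated fixed point and $|\frac{\partial f}{\partial\bar z}(0)|=1$. Such an $f$ is formally conjugate to a series $\bar w+\sum_{n\ge2}A_n\bar w^n$ with real $A_n$; if $k+1$ is the smallest $n\ge2$ with $A_n\neq0$, then $f$ is of codimension $k$, and when $k$ is even $f$ is of positive type if $A_{k+1}>0$. The formal invariant of $f$ is the number $b$ such that $f\circ f$ is holomorphically conjugate to a germ of the form $z+z^{k+1}+(\frac{k+1}2-b)z^{2k+1}+o(z^{2k+1})$; it is real. Formal conjugacy means conjugacy by a formal power series $\sum_{n\ge1}b_nz^n$, $b_1\ne0$. *)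

(* Defs.v *)
(* Over the reals of Stdlib and the complex numbers of Coquelicot. *)
From Stdlib Require Import Reals.
From Coquelicot Require Export Coquelicot.

Open Scope C_scope.

(* A germ at 0 is represented by a total function [C -> C], every condition on
   which only involves its values near 0. *)

Definition has_series (g : C -> C) (a : nat -> C) : Prop :=
  locally (RtoC 0) (fun z => @is_pseries C_AbsRing C_NormedModule a z (g z)).

(* Holomorphic in the sense of Weierstrass: the germs at 0 of holomorphic
   functions are the convergent power series. *)
Definition holomorphic_germ (g : C -> C) : Prop := exists a, has_series g a.

(* [f z = sum_n a_n (Cconj z)^n] near 0. *)
Definition has_antiseries (f : C -> C) (a : nat -> C) : Prop :=
  has_series (fun z => f (Cconj z)) a.

Definition antiholomorphic_germ (f : C -> C) : Prop :=
  exists a, has_antiseries f a.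

(* The Wirtinger derivative (d/dx + i d/dy) / 2. *)
Definition is_dbar (f : C -> C) (z l : C) : Prop :=
  exists fx fy : C,
    @is_derive R_AbsRing C_R_NormedModule (fun t : R => f (z + RtoC t)) 0%R fx
    /\ @is_derive R_AbsRing C_R_NormedModule
         (fun t : R => f (z + Ci * RtoC t)) 0%R fy
    /\ l = (fx + Ci * fy) / 2.

(* The condition on [d f / d zbar] makes the germ a local diffeomorphism. *)
Definition antiholomorphic_parabolic (f : C -> C) : Prop :=
  antiholomorphic_germ f
  /\ f 0 = 0
  /\ locally' (RtoC 0) (fun z => f z <> z)
  /\ (exists l : C, is_dbar f 0 l /\ Cmod l = 1%R).

Definition fps_mul (a b : nat -> C) (n : nat) : C :=
  @sum_n C_AbelianMonoid (fun j => a j * b (n - j)%nat) n.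

Fixpoint fps_pow (a : nat -> C) (m : nat) : nat -> C :=
  match m with
  | O => fun n => match n with O => 1 | S _ => 0 end
  | S m' => fps_mul a (fps_pow a m')
  end.

(* The series [a (h (z))]; meaningful when [h O = 0], in which case the powers
   [h ^ m] with [m > n] do not contribute to the coefficient of [z ^ n]. *)
Definition fps_comp (a h : nat -> C) (n : nat) : C :=
  @sum_n C_AbelianMonoid (fun m => a m * fps_pow h m n) n.

(* [a] and [c] stand for the antiholomorphic formal series
   f (z) = sum a_n zbar^n and g (z) = sum c_n zbar^n without constant term.
   Expanded in powers of zbar, h o f = g o h reads h (a (zbar)) = c (hbar (zbar)),
   where hbar is the series h with conjugated coefficients. *)
Definition formally_conjugate_antiseries (a c : nat -> C) : Prop :=
  a O = 0 /\ c O = 0 /\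
  exists h : nat -> C,
    h O = 0 /\ h 1%nat <> 0
    /\ forall n, fps_comp h a n = fps_comp c (fun j => Cconj (h j)) n.

Definition formally_conjugate (f g : C -> C) : Prop :=
  exists a c, has_antiseries f a /\ has_antiseries g c
              /\ formally_conjugate_antiseries a c.

(* [f] is formally conjugate to wbar + sum_{n >= k+1} A_n wbar^n with real
   coefficients, [k >= 1] and A_(k+1) <> 0. *)
Definition real_form (f : C -> C) (k : nat) (A : nat -> R) : Prop :=
  (exists a, has_antiseries f a
             /\ formally_conjugate_antiseries a (fun n => RtoC (A n)))
  /\ A O = 0%R /\ A 1%nat = 1%R
  /\ (1 <= k)%nat
  /\ A (k + 1)%nat <> 0%R
  /\ (forall n, (2 <= n < k + 1)%nat -> A n = 0%R).

Definition codimension (f : C -> C) (k : nat) : Prop :=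
  exists A, real_form f k A.

Definition positive_type (f : C -> C) (k : nat) : Prop :=
  exists A, real_form f k A /\ (0 < A (k + 1)%nat)%R.

Definition holomorphically_conjugate (F G : C -> C) : Prop :=
  exists h : C -> C,
    (exists b, has_series h b /\ b O = 0 /\ b 1%nat <> 0)
    /\ locally (RtoC 0) (fun z => h (F z) = G (h z)).

Definition formal_invariant (f : C -> C) (k : nat) (b : C) : Prop :=
  exists G : C -> C,
    holomorphic_germ G
    /\ @is_domin C C_AbsRing C_AbsRing C_NormedModule C_NormedModule
         (locally (RtoC 0))
         (fun z => z ^ (2 * k + 1))
         (fun z => G z - (z + z ^ (k + 1)
                          + (RtoC (INR (k + 1) / 2) - b) * z ^ (2 * k + 1)))
    /\ holomorphically_conjugate (fun z => f (f z)) G.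

(* [V] is, near 0, the time-[tau] map of zdot = X (z), the vector field X being
   defined on [D]. *)
Definition time_map (D : C -> Prop) (X : C -> C) (tau : R) (V : C -> C) : Prop :=
  locally (RtoC 0) (fun z =>
    exists gamma : R -> C,
      gamma 0%R = z
      /\ (forall t : R, (0 <= t <= tau)%R ->
            D (gamma t)
            /\ @is_derive R_AbsRing C_R_NormedModule gamma t (X (gamma t)))
      /\ gamma tau = V z).

Definition model_domain (k : nat) (b z : C) : Prop := 1 + b * z ^ k <> 0.

Definition model_field (k : nat) (b z : C) : C := z ^ (k + 1) / (1 + b * z ^ k).

(* Main.v *)
Require Import Defs.
From Stdlib Require Import Reals Lra Lia Arith FunctionalExtensionality.
From Coquelicot Require Import Coquelicot.

(** The theorem is a statement about formal power series, once the germs have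
    been replaced by their expansions at the origin.

    Write [a] for the series of [f], so that [f o f] has the series [a o abar],
    and [v] for the series of the half-time map, which is real when [b] is. Let
    [h0] conjugate [a] to the real series [A], that is [h0 o a = A o h0bar]; then
    the same [h0] conjugates [a o abar] to [A o A]. The square [A o A] and the
    time-one map [W = v o v] are holomorphic parabolic series. The conjugacy
    equation [h o P = Q o h] between two such series of codimension [k] can be
    solved degree by degree: in degree [k + j] the unknown coefficient [h_j] has
    the factor [j - (k + 1)] ([defect_perturb]), so that the only obstruction lies
    in degree [2 k + 1], and the coefficients of [h] other than those of degrees
    [1] and [k + 1] are determined by these two ([conjugacy_extend],
    [conjugacy_unique]). The obstruction is the coefficient of [z^(2k+1)] in the
    normalised form ([residue_invariant]). Three consequences follow.
    - The normal form [g] of [f o f] is conjugate to the real series [A o A], hence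
      to its own complex conjugate, so that [b] is real.
    - The series [W] has the same coefficients as [g] up to degree [2 k + 1], by a
      computation from [v = z + z^(k+1) / 2 + ((k+1) / 8 - b / 2) z^(2k+1) + ...].
      Hence [A o A] is conjugate to [W].
    - The conjugacy can be chosen real. Its linear part [l] satisfies
      [l^k = 2 A_(k+1)], which has a real solution: this is where the sign of
      [A_(k+1)] matters for even [k]. As [W] commutes with the rotations of order
      [k], the linear part may be rotated onto the real axis, and the resonant
      coefficient may be set to zero; by uniqueness the conjugacy is then equal to
      its complex conjugate.
    A parabolic series has a single compositional square root tangent to the
    identity ([square_root_cancel]). So a real [h] conjugating [A o A] to [v o v]
    conjugates [A] to [v], and being real it also conjugates the antiholomorphic
    series ([formal_classification]).

    The analytic part of the proof is to show that the half-time map has a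
    convergent expansion. Along a trajectory [gamma] starting at [z] set
    [Y = gamma^k / (1 + b gamma^k)]. Then [gamma' = gamma Y] and
    [Y' = k (Y^2 - b Y^3)], with [Y(0)] a power series in [w = z^k]. The formal
    solution of this system as a power series in [w], with coefficients depending
    on the time, is bounded by a majorant that converges for small [w]
    ([y_bound], [x_bound]). Its truncations are approximate solutions with error
    [O(2^(-N))], hence close to the trajectory by Gronwall's inequality
    ([flow_estimate]). *)

Local Open Scope C_scope.

Implicit Types a b c d u v : nat -> C.

(** * Finite sums *)

Definition csum (f : nat -> C) (n : nat) : C := @sum_n C_AbelianMonoid f n.
Definition rsum (f : nat -> R) (n : nat) : R := @sum_n R_AbelianMonoid f n.

Lemma csum_S (f : nat -> C) (n : nat) : csum f (S n) = csum f n + f (S n).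
Proof. exact (sum_Sn f n). Qed.

Lemma csum_O (f : nat -> C) : csum f O = f O.
Proof. exact (sum_O f). Qed.

Lemma rsum_S (f : nat -> R) (n : nat) : rsum f (S n) = (rsum f n + f (S n))%R.
Proof. exact (sum_Sn f n). Qed.

Lemma rsum_O (f : nat -> R) : rsum f O = f O.
Proof. exact (sum_O f). Qed.

Lemma csum_plus (f g : nat -> C) (n : nat) :
  csum (fun i => f i + g i) n = csum f n + csum g n.
Proof. exact (sum_n_plus f g n). Qed.

Lemma csum_scal (c : C) (f : nat -> C) (n : nat) :
  csum (fun i => c * f i) n = c * csum f n.
Proof. exact (sum_n_mult_l (K := C_Ring) c f n). Qed.

Lemma csum_minus (f g : nat -> C) (n : nat) :
  csum (fun i => f i - g i) n = csum f n - csum g n.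
Proof.
  induction n as [|n IH]; [rewrite !csum_O; ring|].
  rewrite !csum_S, IH; ring.
Qed.

Lemma csum_ext (f g : nat -> C) (n : nat) :
  (forall i, (i <= n)%nat -> f i = g i) -> csum f n = csum g n.
Proof. intros H. apply sum_n_ext_loc. exact H. Qed.

Lemma rsum_ext (f g : nat -> R) (n : nat) :
  (forall i, (i <= n)%nat -> f i = g i) -> rsum f n = rsum g n.
Proof. intros H. apply sum_n_ext_loc. exact H. Qed.

Lemma csum_zero (f : nat -> C) (n : nat) :
  (forall i, (i <= n)%nat -> f i = 0) -> csum f n = 0.
Proof.
  induction n as [|n IH]; intros H.
  - rewrite csum_O; auto.
  - rewrite csum_S, IH, H; auto; try ring.
Qed.

Lemma csum_single (f : nat -> C) (n k : nat) :
  (k <= n)%nat -> (forall i, (i <= n)%nat -> i <> k -> f i = 0) ->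
  csum f n = f k.
Proof.
  induction n as [|n IH]; intros Hk H.
  - replace k with O by lia. apply csum_O.
  - rewrite csum_S. destruct (Nat.eq_dec k (S n)) as [->|Hne].
    + rewrite csum_zero; [ring|]. intros i Hi; apply H; lia.
    + rewrite IH, (H (S n)); try lia; [ring|].
      intros i Hi Hik; apply H; lia.
Qed.

Lemma Cmod_csum (f : nat -> C) (n : nat) :
  (Cmod (csum f n) <= rsum (fun i => Cmod (f i)) n)%R.
Proof.
  induction n as [|n IH].
  - rewrite csum_O, rsum_O; lra.
  - rewrite csum_S, rsum_S.
    eapply Rle_trans; [apply Cmod_triangle|]. lra.
Qed.

Lemma csum_conj (f : nat -> C) (n : nat) :
  Cconj (csum f n) = csum (fun i => Cconj (f i)) n.
Proof.
  induction n as [|n IH]; [rewrite !csum_O; auto|].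
  rewrite !csum_S, Cplus_conj, IH; auto.
Qed.

Lemma rsum_le (f g : nat -> R) (n : nat) :
  (forall i, (i <= n)%nat -> (f i <= g i)%R) -> (rsum f n <= rsum g n)%R.
Proof.
  induction n as [|n IH]; intros H.
  - rewrite !rsum_O; auto.
  - rewrite !rsum_S. apply Rplus_le_compat; auto.
Qed.

Lemma rsum_scal (c : R) (f : nat -> R) (n : nat) :
  rsum (fun i => (c * f i)%R) n = (c * rsum f n)%R.
Proof. exact (sum_n_mult_l (K := R_Ring) c f n). Qed.

Lemma rsum_plus (f g : nat -> R) (n : nat) :
  rsum (fun i => (f i + g i)%R) n = (rsum f n + rsum g n)%R.
Proof. exact (sum_n_plus f g n). Qed.

Lemma rsum_nonneg (f : nat -> R) (n : nat) :
  (forall i, (i <= n)%nat -> (0 <= f i)%R) -> (0 <= rsum f n)%R.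
Proof.
  induction n as [|n IH]; intros H.
  - rewrite rsum_O; auto.
  - rewrite rsum_S. apply Rplus_le_le_0_compat; auto.
Qed.

Lemma rsum_mono (f : nat -> R) (n m : nat) :
  (n <= m)%nat -> (forall i, (i <= m)%nat -> (0 <= f i)%R) ->
  (rsum f n <= rsum f m)%R.
Proof.
  induction m as [|m IH]; intros Hnm H.
  - replace n with O by lia; lra.
  - destruct (Nat.eq_dec n (S m)) as [->|Hne]; [lra|].
    rewrite rsum_S. specialize (H (S m) (le_n _)) as H1.
    assert (rsum f n <= rsum f m)%R by (apply IH; auto; lia). lra.
Qed.

Lemma sum_triangle {G : AbelianMonoid} (g : nat -> nat -> G) (N : nat) :
  sum_n (fun n => sum_n (fun i => g i (n - i)%nat) n) N
  = sum_n (fun i => sum_n (g i) (N - i)) N.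
Proof.
  induction N as [|N IH].
  - reflexivity.
  - rewrite sum_Sn, IH, !sum_Sn, Nat.sub_diag, sum_O, plus_assoc.
    f_equal. rewrite <- sum_n_plus. apply sum_n_ext_loc. intros i Hi.
    replace (S N - i)%nat with (S (N - i)) by lia. now rewrite sum_Sn.
Qed.

Lemma csum_triangle (g : nat -> nat -> C) (N : nat) :
  csum (fun n => csum (fun i => g i (n - i)%nat) n) N
  = csum (fun i => csum (g i) (N - i)) N.
Proof. exact (sum_triangle g N). Qed.

Lemma rsum_triangle (g : nat -> nat -> R) (N : nat) :
  rsum (fun n => rsum (fun i => g i (n - i)%nat) n) N
  = rsum (fun i => rsum (g i) (N - i)) N.
Proof. exact (sum_triangle g N). Qed.

(** * Truncated power series *)

Definition psum (a : nat -> C) (N : nat) (z : C) : C :=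
  csum (fun n => a n * z ^ n) N.

Definition rpsum (a : nat -> R) (N : nat) (r : R) : R :=
  rsum (fun n => a n * r ^ n)%R N.

Definition cabs (a : nat -> C) (n : nat) : R := Cmod (a n).

Lemma psum_S a N z : psum a (S N) z = psum a N z + a (S N) * z ^ S N.
Proof. apply csum_S. Qed.

Lemma rpsum_S (a : nat -> R) N r : rpsum a (S N) r = (rpsum a N r + a (S N) * r ^ S N)%R.
Proof. apply rsum_S. Qed.

Lemma psum_O a z : psum a O z = a O.
Proof. unfold psum; rewrite csum_O. cbn [Cpow]. ring. Qed.

Lemma rpsum_O (a : nat -> R) r : rpsum a O r = a O.
Proof. unfold rpsum; rewrite rsum_O. cbn [pow]. ring. Qed.

Lemma rpsum_term_nonneg (a : nat -> C) r i :
  (0 <= r)%R -> (0 <= cabs a i * r ^ i)%R.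
Proof. intros Hr. apply Rmult_le_pos; [apply Cmod_ge_0 | now apply pow_le]. Qed.

Lemma rpsum_nonneg a N r : (0 <= r)%R -> (0 <= rpsum (cabs a) N r)%R.
Proof. intros Hr. apply rsum_nonneg; intros; now apply rpsum_term_nonneg. Qed.

Lemma Cmod_psum_le a N z r :
  (Cmod z <= r)%R -> (Cmod (psum a N z) <= rpsum (cabs a) N r)%R.
Proof.
  intros H. eapply Rle_trans; [apply Cmod_csum|]. apply rsum_le. intros i _.
  rewrite Cmod_mult, Cmod_pow. apply Rmult_le_compat_l; [apply Cmod_ge_0|].
  apply pow_incr. split; [apply Cmod_ge_0 | exact H].
Qed.

Lemma psum_ext a b N z :
  (forall i, (i <= N)%nat -> a i = b i) -> psum a N z = psum b N z.
Proof. intros H. apply csum_ext. intros i Hi. now rewrite H. Qed.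

(** A term of degree [i > n] shrinks by at least [th^(n+1)] from radius [r] to
    radius [th r]. With [r = 1] and [th = |z|] this gives Taylor remainders, with
    [th = 1/2] geometric errors. *)
Lemma psum_tail a r th z n N :
  (0 <= r)%R -> (0 <= th <= 1)%R -> (Cmod z <= th * r)%R -> (n <= N)%nat ->
  (Cmod (psum a N z - psum a n z)
   <= th ^ S n * (rpsum (cabs a) N r - rpsum (cabs a) n r))%R.
Proof.
  intros Hr [Hth Hth1] Hz. induction N as [|N IH]; intros HnN.
  - replace n with O by lia.
    replace (psum a 0 z - psum a 0 z) with (RtoC 0) by ring.
    rewrite Cmod_0. lra.
  - destruct (Nat.eq_dec n (S N)) as [->|Hne].
    + replace (psum a (S N) z - psum a (S N) z) with (RtoC 0) by ring.
      rewrite Cmod_0. lra.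
    + rewrite psum_S, rpsum_S.
      replace (psum a N z + a (S N) * z ^ S N - psum a n z)
        with ((psum a N z - psum a n z) + a (S N) * z ^ S N) by ring.
      eapply Rle_trans; [apply Cmod_triangle|].
      assert (H1 := IH ltac:(lia)).
      rewrite Cmod_mult, Cmod_pow.
      assert (H2 : (Cmod z ^ S N <= th ^ S n * r ^ S N)%R).
      { apply Rle_trans with ((th * r) ^ S N)%R.
        - apply pow_incr. split; [apply Cmod_ge_0 | exact Hz].
        - rewrite Rpow_mult_distr. apply Rmult_le_compat_r; [now apply pow_le|].
          replace (S N) with (S n + (N - n))%nat by lia. rewrite pow_add.
          rewrite <- (Rmult_1_r (th ^ S n)) at 2.
          apply Rmult_le_compat_l; [now apply pow_le|].
          rewrite <- (pow1 (N - n)). apply pow_incr; lra. }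
      assert (H3 := Rmult_le_compat_l _ _ _ (Cmod_ge_0 (a (S N))) H2).
      change (cabs a (S N)) with (Cmod (a (S N))). lra.
Qed.

(** Multiplying two truncated series and truncating the product differ by the
    terms [a_i b_j z^(i+j)] with [i, j <= N < i + j]. *)
Lemma psum_mul_trunc a b r th z N :
  (0 <= r)%R -> (0 <= th <= 1)%R -> (Cmod z <= th * r)%R ->
  (Cmod (psum a N z * psum b N z - psum (fps_mul a b) N z)
   <= th ^ S N * (rpsum (cabs a) N r * rpsum (cabs b) N r))%R.
Proof.
  intros Hr Hth Hz.
  assert (E : psum a N z * psum b N z - psum (fps_mul a b) N z
              = csum (fun i => a i * z ^ i * (psum b N z - psum b (N - i) z)) N).
  { transitivity (csum (fun i => a i * z ^ i * psum b N z
                                 - a i * z ^ i * psum b (N - i) z) N).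
    2:{ apply csum_ext; intros; ring. }
    rewrite csum_minus. f_equal.
    - rewrite (Cmult_comm (psum a N z)). unfold psum at 2.
      rewrite <- csum_scal. apply csum_ext; intros; ring.
    - f_equal. unfold psum.
      transitivity (csum (fun i => csum (fun j => a i * z ^ i * (b j * z ^ j)) (N - i)) N).
      + rewrite <- csum_triangle. apply csum_ext. intros n Hn.
        unfold fps_mul. fold (csum (fun j => a j * b (n - j)%nat) n).
        rewrite (Cmult_comm (csum _ n)), <- csum_scal. apply csum_ext. intros i Hi.
        replace (z ^ n) with (z ^ i * z ^ (n - i)%nat).
        2:{ rewrite <- Cpow_add_r. f_equal. lia. }
        ring.
      + apply csum_ext. intros i Hi. now rewrite csum_scal. }
  rewrite E. eapply Rle_trans; [apply Cmod_csum|].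
  eapply Rle_trans.
  { apply (rsum_le _ (fun i => (th ^ S N * rpsum (cabs b) N r) * (cabs a i * r ^ i))%R).
    intros i Hi. rewrite !Cmod_mult, Cmod_pow.
    assert (H1 := psum_tail b r th z (N - i) N Hr Hth Hz ltac:(lia)).
    assert (H2 := rpsum_nonneg b (N - i) r Hr).
    assert (H3 : (Cmod (psum b N z - psum b (N - i) z)
                  <= th ^ S (N - i) * rpsum (cabs b) N r)%R).
    { eapply Rle_trans; [exact H1|]. apply Rmult_le_compat_l; [apply pow_le; lra | lra]. }
    assert (H4 : (Cmod z ^ i <= th ^ i * r ^ i)%R).
    { rewrite <- Rpow_mult_distr. apply pow_incr. split; [apply Cmod_ge_0 | exact Hz]. }
    apply Rle_trans with
      (Cmod (a i) * (th ^ i * r ^ i) * (th ^ S (N - i) * rpsum (cabs b) N r))%R.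
    - apply Rmult_le_compat; auto.
      + apply Rmult_le_pos; [apply Cmod_ge_0 | apply pow_le, Cmod_ge_0].
      + apply Cmod_ge_0.
      + apply Rmult_le_compat_l; [apply Cmod_ge_0 | exact H4].
    - replace (S N) with (i + S (N - i))%nat by lia. rewrite pow_add. unfold cabs.
      apply Req_le. ring. }
  rewrite rsum_scal. apply Req_le. fold (rpsum (cabs a) N r). ring.
Qed.

(** * Algebra of formal power series *)

Lemma fps_mulE a b n : fps_mul a b n = csum (fun j => a j * b (n - j)%nat) n.
Proof. reflexivity. Qed.

Lemma fps_compE a (h : nat -> C) n : fps_comp a h n = csum (fun m => a m * fps_pow h m n) n.
Proof. reflexivity. Qed.

(** Valuations add up, and the lowest coefficients multiply. *)
Lemma fps_mul_low u v p q :
  (forall i, (i < p)%nat -> u i = 0) -> (forall i, (i < q)%nat -> v i = 0) ->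
  (forall n, (n < p + q)%nat -> fps_mul u v n = 0)
  /\ fps_mul u v (p + q) = u p * v q.
Proof.
  intros Hu Hv. split.
  - intros n Hn. rewrite fps_mulE. apply csum_zero. intros i Hi.
    destruct (lt_dec i p) as [H|H]; [rewrite Hu by lia | rewrite (Hv (n - i)%nat) by lia];
      ring.
  - rewrite fps_mulE, (csum_single _ _ p); [|lia|].
    + replace (p + q - p)%nat with q by lia. reflexivity.
    + intros i Hi Hip. destruct (lt_dec i p) as [H|H];
        [rewrite Hu by lia | rewrite (Hv (p + q - i)%nat) by lia]; ring.
Qed.

Lemma fps_mul_diff u u' v v' n :
  fps_mul u v n - fps_mul u' v' n
  = fps_mul (fun i => u i - u' i) v n + fps_mul u' (fun i => v i - v' i) n.
Proof.
  rewrite !fps_mulE, <- csum_minus, <- csum_plus.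
  apply csum_ext; intros; ring.
Qed.

Lemma fps_pow_low (h : nat -> C) m :
  h O = 0 ->
  (forall n, (n < m)%nat -> fps_pow h m n = 0) /\ fps_pow h m m = h 1%nat ^ m.
Proof.
  intros H0. induction m as [|m [IH1 IH2]].
  - split; [intros; lia | reflexivity].
  - destruct (fps_mul_low h (fps_pow h m) 1 m) as [H1 H2]; auto.
    + intros i Hi. replace i with O by lia. exact H0.
    + split; [exact H1|]. change (S m) with (1 + m)%nat at 2.
      cbn [fps_pow]. rewrite H2, IH2, Cpow_S. reflexivity.
Qed.

(** Perturbing [h] in degree [j] perturbs [h ^ m] in degree [m - 1 + j] first,
    to first order as the derivative [m h^(m-1)] predicts. *)
Lemma fps_pow_perturb (h : nat -> C) (h' : nat -> C) j m :
  h O = 0 -> h' O = 0 -> (1 <= j)%nat ->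
  (forall i, (i < j)%nat -> h i = h' i) ->
  (forall n, (n + 1 < m + j)%nat -> fps_pow h m n = fps_pow h' m n)
  /\ ((2 <= j)%nat -> forall n, (n + 1 = m + j)%nat ->
      fps_pow h m n - fps_pow h' m n
      = RtoC (INR m) * h 1%nat ^ (m - 1) * (h j - h' j)).
Proof.
  intros H0 H0' Hj Hag. induction m as [|m [IH1 IH2]].
  - split; [reflexivity|]. intros Hj2 n Hn. cbn. ring.
  - pose (d := fun i => h i - h' i).
    pose (e := fun i => fps_pow h m i - fps_pow h' m i).
    assert (Hd : forall i, (i < j)%nat -> d i = 0).
    { intros i Hi. unfold d. rewrite Hag by exact Hi. ring. }
    assert (He : forall i, (i < m - 1 + j)%nat -> e i = 0).
    { intros i Hi. unfold e. destruct (Nat.eq_dec m 0) as [->|Hm]; [cbn; ring|].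
      rewrite IH1 by lia. ring. }
    destruct (fps_pow_low h m H0) as [Hl1 Hl2].
    destruct (fps_mul_low d (fps_pow h m) j m Hd Hl1) as [D1 D2].
    assert (Hh' : forall i, (i < 1)%nat -> h' i = 0).
    { intros i Hi. replace i with O by lia. exact H0'. }
    destruct (fps_mul_low h' e 1 (m - 1 + j) Hh' He) as [E1 E2].
    assert (Hm0 : m = O -> forall n, fps_mul h' e n = 0).
    { intros -> n. rewrite fps_mulE. apply csum_zero. intros i Hi.
      unfold e. cbn. ring. }
    split.
    + intros n Hn. apply Ceq_minus. cbn [fps_pow]. rewrite fps_mul_diff.
      fold d e. rewrite D1 by lia.
      destruct (Nat.eq_dec m 0) as [Hm|Hm]; [rewrite Hm0 by exact Hm | rewrite E1 by lia];
        ring.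
    + intros Hj2 n Hn. cbn [fps_pow]. rewrite fps_mul_diff. fold d e.
      replace n with (j + m)%nat by lia. rewrite D2, Hl2.
      destruct (Nat.eq_dec m 0) as [Hm|Hm].
      * rewrite Hm0 by exact Hm. subst m. cbn. unfold d. ring.
      * replace (j + m)%nat with (1 + (m - 1 + j))%nat by lia. rewrite E2.
        unfold e. rewrite IH2 by lia. rewrite <- (Hag 1%nat) by lia.
        rewrite S_INR, RtoC_plus. replace (S m - 1)%nat with (S (m - 1)) by lia.
        replace (h 1%nat ^ m) with (h 1%nat ^ S (m - 1)) by (f_equal; lia).
        rewrite !Cpow_S. unfold d. ring.
Qed.

Definition fps_id (n : nat) : C := if (n =? 1)%nat then 1 else 0.

Lemma fps_pow_scale (l : C) m n :
  fps_pow (fun i => l * fps_id i) m n = if (n =? m)%nat then l ^ m else 0.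
Proof.
  revert n. induction m as [|m IH]; intros n.
  - destruct n; reflexivity.
  - cbn [fps_pow]. rewrite fps_mulE. destruct n as [|n].
    + rewrite csum_O. unfold fps_id. cbn. ring.
    + rewrite (csum_single _ _ 1%nat); [|lia|].
      * rewrite IH. replace (S n - 1)%nat with n by lia. cbn [Nat.eqb].
        unfold fps_id. cbn [Nat.eqb]. destruct (n =? m)%nat; rewrite ?Cpow_S; ring.
      * intros i _ Hi. unfold fps_id. apply Nat.eqb_neq in Hi. rewrite Hi. ring.
Qed.

Lemma fps_comp_scale_l l (h : nat -> C) n :
  h O = 0 -> fps_comp (fun i => l * fps_id i) h n = l * h n.
Proof.
  intros H0. rewrite fps_compE. destruct n as [|n].
  - rewrite csum_O, H0. unfold fps_id. cbn. ring.
  - rewrite (csum_single _ _ 1%nat); [|lia|].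
    + unfold fps_id. cbn [Nat.eqb fps_pow]. rewrite fps_mulE, (csum_single _ _ (S n)); [|lia|].
      * rewrite Nat.sub_diag. ring.
      * intros i Hi Hne. destruct (S n - i)%nat eqn:E; [lia | ring].
    + intros i _ Hi. unfold fps_id. apply Nat.eqb_neq in Hi. rewrite Hi. ring.
Qed.

Lemma fps_comp_scale_r a l n :
  fps_comp a (fun i => l * fps_id i) n = a n * l ^ n.
Proof.
  rewrite fps_compE, (csum_single _ _ n); [|lia|].
  - rewrite fps_pow_scale, Nat.eqb_refl. reflexivity.
  - intros i _ Hi. rewrite fps_pow_scale. apply Nat.eqb_neq in Hi.
    rewrite Nat.eqb_sym, Hi. ring.
Qed.

Lemma fps_comp_O a (h : nat -> C) : fps_comp a h O = a O.
Proof. rewrite fps_compE, csum_O. cbn. ring. Qed.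

Lemma fps_comp_1 a (h : nat -> C) : h O = 0 -> fps_comp a h 1%nat = a 1%nat * h 1%nat.
Proof.
  intros H. rewrite fps_compE, csum_S, csum_O. destruct (fps_pow_low h 1 H) as [_ E].
  rewrite E. cbn. ring.
Qed.

Definition fps_conj (a : nat -> C) (n : nat) : C := Cconj (a n).

Lemma fps_conj_invol a : fps_conj (fps_conj a) = a.
Proof. apply functional_extensionality; intros n. apply Cconj_conj. Qed.

Lemma Cconj_RtoC (x : R) : Cconj (RtoC x) = RtoC x.
Proof. unfold Cconj, RtoC. cbn. f_equal. ring. Qed.

Lemma fps_conj_pow a m n : fps_conj (fps_pow a m) n = fps_pow (fps_conj a) m n.
Proof.
  revert n. induction m as [|m IH]; intros n.
  - unfold fps_conj. destruct n; cbn [fps_pow]; apply Cconj_RtoC.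
  - unfold fps_conj at 1. cbn [fps_pow]. rewrite !fps_mulE, csum_conj.
    apply csum_ext. intros i Hi. rewrite Cmult_conj, <- IH. reflexivity.
Qed.

Lemma fps_conj_comp a (h : nat -> C) : fps_conj (fps_comp a h) = fps_comp (fps_conj a) (fps_conj h).
Proof.
  apply functional_extensionality; intros n. unfold fps_conj at 1.
  rewrite !fps_compE, csum_conj. apply csum_ext. intros i Hi.
  rewrite Cmult_conj, <- fps_conj_pow. reflexivity.
Qed.

(** * Asymptotic expansions at the origin *)

Definition near0 (P : C -> Prop) : Prop :=
  exists r : R, (0 < r)%R /\ forall z, (Cmod z < r)%R -> P z.

Lemma locally_near0 (P : C -> Prop) :
  @locally C_UniformSpace (RtoC 0) P <-> near0 P.
Proof.
  rewrite (locally_C (RtoC 0) P).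
  assert (E : forall w : C, w - RtoC 0 = w) by (intros; ring).
  split; intros [r Hr].
  - exists (pos r). split; [apply cond_pos|]. intros z Hz. apply Hr.
    change (Cmod (z - RtoC 0) < r)%R. now rewrite E.
  - destruct Hr as [H0 Hr]. exists (mkposreal r H0). intros z Hz. apply Hr.
    change (Cmod (z - RtoC 0) < r)%R in Hz. now rewrite E in Hz.
Qed.

Lemma near0_and P Q : near0 P -> near0 Q -> near0 (fun z => P z /\ Q z).
Proof.
  intros (r & Hr & HP) (s & Hs & HQ). exists (Rmin r s). split.
  - now apply Rmin_pos.
  - intros z Hz. split; [apply HP | apply HQ]; eapply Rlt_le_trans; eauto;
      [apply Rmin_l | apply Rmin_r].
Qed.

Lemma near0_imp P Q : (forall z, P z -> Q z) -> near0 P -> near0 Q.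
Proof. intros H (r & Hr & HP). exists r. split; auto. Qed.

Lemma near0_lt (s : R) : (0 < s)%R -> near0 (fun z => (Cmod z < s)%R).
Proof. intros Hs. now exists s. Qed.

Definition bigO (N : nat) (g : C -> C) : Prop :=
  exists K : R, (0 <= K)%R /\ near0 (fun z => (Cmod (g z) <= K * Cmod z ^ N)%R).

Lemma bigO_ext N (g h : C -> C) : near0 (fun z => g z = h z) -> bigO N g -> bigO N h.
Proof.
  intros H (K & HK & Hg). exists K. split; [exact HK|].
  refine (near0_imp _ _ _ (near0_and _ _ H Hg)). intros z [<- Hz]. exact Hz.
Qed.

Lemma bigO_ext' N (g h : C -> C) : (forall z, g z = h z) -> bigO N g -> bigO N h.
Proof. intros H. apply bigO_ext. exists 1%R. split; [lra | auto]. Qed.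

Lemma bigO_plus N (g h : C -> C) : bigO N g -> bigO N h -> bigO N (fun z => g z + h z).
Proof.
  intros (K & HK & Hg) (L & HL & Hh). exists (K + L)%R. split; [lra|].
  refine (near0_imp _ _ _ (near0_and _ _ Hg Hh)). intros z [H1 H2].
  eapply Rle_trans; [apply Cmod_triangle | lra].
Qed.

Lemma bigO_mult N M (g h : C -> C) :
  bigO N g -> bigO M h -> bigO (N + M) (fun z => g z * h z).
Proof.
  intros (K & HK & Hg) (L & HL & Hh). exists (K * L)%R.
  split; [now apply Rmult_le_pos|].
  refine (near0_imp _ _ _ (near0_and _ _ Hg Hh)). intros z [H1 H2].
  rewrite Cmod_mult, pow_add.
  replace (K * L * (Cmod z ^ N * Cmod z ^ M))%R
    with ((K * Cmod z ^ N) * (L * Cmod z ^ M))%R by ring.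
  apply Rmult_le_compat; auto using Cmod_ge_0.
Qed.

Lemma bigO_weaken N M (g : C -> C) : (M <= N)%nat -> bigO N g -> bigO M g.
Proof.
  intros HMN (K & HK & Hg). exists K. split; [exact HK|].
  refine (near0_imp _ _ _ (near0_and _ _ Hg (near0_lt 1 ltac:(lra)))).
  intros z [H1 H2]. eapply Rle_trans; [exact H1|].
  apply Rmult_le_compat_l; [exact HK|].
  replace N with (M + (N - M))%nat by lia. rewrite pow_add.
  rewrite <- (Rmult_1_r (Cmod z ^ M)) at 2.
  apply Rmult_le_compat_l; [apply pow_le, Cmod_ge_0|].
  rewrite <- (pow1 (N - M)). apply pow_incr. split; [apply Cmod_ge_0 | lra].
Qed.

Lemma bigO_scal N (l : C) (g : C -> C) : bigO N g -> bigO N (fun z => l * g z).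
Proof.
  intros Hg. apply (bigO_mult 0 N (fun _ => l)); [|exact Hg].
  exists (Cmod l). split; [apply Cmod_ge_0|]. apply (near0_imp (fun _ => True)).
  - intros z _. cbn [pow]. lra.
  - exists 1%R. split; [lra | auto].
Qed.

Lemma bigO_psum a N M : (forall i, (i < M)%nat -> a i = 0) -> bigO M (psum a N).
Proof.
  intros Ha. exists (rpsum (cabs a) N 1). split; [apply rpsum_nonneg; lra|].
  refine (near0_imp _ _ _ (near0_lt 1 ltac:(lra))). intros z Hz.
  destruct M as [|M].
  - cbn [pow]. rewrite Rmult_1_r. apply Cmod_psum_le. lra.
  - destruct (le_lt_dec M N) as [H|H].
    + replace (psum a N z) with (psum a N z - psum a M z).
      2:{ assert (E : psum a M z = 0).
          { apply csum_zero. intros i Hi. rewrite Ha by lia. ring. }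
          rewrite E. ring. }
      eapply Rle_trans.
      { apply (psum_tail a 1 (Cmod z)); try lra; [|exact H].
        split; [apply Cmod_ge_0 | lra]. }
      rewrite (Rmult_comm (rpsum _ _ _)). apply Rmult_le_compat_l.
      * apply pow_le, Cmod_ge_0.
      * assert (H1 := rpsum_nonneg a M 1 ltac:(lra)). lra.
    + assert (E : psum a N z = 0).
      { apply csum_zero. intros i Hi. rewrite Ha by lia. ring. }
      rewrite E, Cmod_0. apply Rmult_le_pos; [apply rpsum_nonneg; lra|].
      apply pow_le, Cmod_ge_0.
Qed.

(** [g z = a_0 + ... + a_N z^N + O(z^(N+1))]: this is all that the comparison of
    coefficients uses of a convergent series, and it composes without any
    rearrangement of infinite sums. *)
Definition expands (N : nat) (g : C -> C) (a : nat -> C) : Prop :=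
  bigO (S N) (fun z => g z - psum a N z).

Lemma expands_psum a N : expands N (psum a N) a.
Proof.
  exists 0%R. split; [lra|]. exists 1%R. split; [lra|]. intros z _.
  replace (psum a N z - psum a N z) with (RtoC 0) by ring. rewrite Cmod_0. lra.
Qed.

Lemma expands_ext N (g h : C -> C) a b :
  near0 (fun z => g z = h z) -> (forall i, (i <= N)%nat -> a i = b i) ->
  expands N g a -> expands N h b.
Proof.
  intros H Hab. apply bigO_ext. refine (near0_imp _ _ _ H). intros z ->.
  now rewrite (psum_ext a b) by exact Hab.
Qed.

Lemma expands_plus N (g h : C -> C) a b :
  expands N g a -> expands N h b -> expands N (fun z => g z + h z) (fun n => a n + b n).
Proof.
  intros Ha Hb. refine (bigO_ext' _ _ _ _ (bigO_plus _ _ _ Ha Hb)). intros z. cbv beta.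
  assert (E : psum (fun n => a n + b n) N z = psum a N z + psum b N z).
  { unfold psum. rewrite <- csum_plus. apply csum_ext; intros; ring. }
  rewrite E. ring.
Qed.

Lemma expands_scal N (l : C) (g : C -> C) a :
  expands N g a -> expands N (fun z => l * g z) (fun n => l * a n).
Proof.
  intros Ha. refine (bigO_ext' _ _ _ _ (bigO_scal _ l _ Ha)). intros z. cbv beta.
  assert (E : psum (fun n => l * a n) N z = l * psum a N z).
  { unfold psum. rewrite <- csum_scal. apply csum_ext; intros; ring. }
  rewrite E. ring.
Qed.

Lemma expands_bigO N (g : C -> C) a M :
  (M <= S N)%nat -> (forall i, (i < M)%nat -> a i = 0) -> expands N g a -> bigO M g.
Proof.
  intros HM Ha Hg.
  refine (bigO_ext' _ _ _ _ (bigO_plus _ _ _ (bigO_weaken _ M _ HM Hg) (bigO_psum a N M Ha))).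
  intros z. cbv beta. ring.
Qed.

(** The product of the truncations exceeds the truncated product by terms of
    degree greater than [N]. *)
Lemma expands_mult N (g h : C -> C) a b :
  expands N g a -> expands N h b -> expands N (fun z => g z * h z) (fps_mul a b).
Proof.
  intros Ha Hb.
  assert (Hh : bigO 0 h) by (apply (expands_bigO N h b); [lia | lia | exact Hb]).
  assert (H1 := bigO_mult _ _ _ _ Ha Hh). rewrite Nat.add_0_r in H1.
  assert (H2 := bigO_mult _ _ _ _ (bigO_psum a N 0 ltac:(lia)) Hb). cbn [Nat.add] in H2.
  assert (H3 : bigO (S N) (fun z => psum a N z * psum b N z - psum (fps_mul a b) N z)).
  { exists (rpsum (cabs a) N 1 * rpsum (cabs b) N 1)%R. split.
    - apply Rmult_le_pos; apply rpsum_nonneg; lra.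
    - refine (near0_imp _ _ _ (near0_lt 1 ltac:(lra))). intros z Hz.
      rewrite (Rmult_comm _ (Cmod z ^ S N)). apply psum_mul_trunc; try lra.
      split; [apply Cmod_ge_0 | lra]. }
  refine (bigO_ext' _ _ _ _ (bigO_plus _ _ _ (bigO_plus _ _ _ H1 H2) H3)).
  intros z. cbv beta. ring.
Qed.

Lemma expands_pow N (h : C -> C) b m :
  expands N h b -> expands N (fun z => h z ^ m) (fps_pow b m).
Proof.
  intros Hb. induction m as [|m IH].
  - refine (expands_ext _ _ _ _ _ _ _ (expands_psum (fps_pow b 0) N)); [|auto].
    exists 1%R. split; [lra|]. intros z _.
    unfold psum. rewrite (csum_single _ _ 0); [cbn; ring | lia|].
    intros [|i] _ Hi; [easy | cbn; ring].
  - refine (expands_ext _ _ _ _ _ _ _ (expands_mult _ _ _ _ _ Hb IH)); [|auto].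
    exists 1%R. split; [lra|]. intros z _. reflexivity.
Qed.

Lemma expands_csum N (M : nat) (G : nat -> C -> C) (A : nat -> nat -> C) :
  (forall m, expands N (G m) (A m)) ->
  expands N (fun z => csum (fun m => G m z) M) (fun n => csum (fun m => A m n) M).
Proof.
  intros H. induction M as [|M IH].
  - refine (expands_ext _ _ _ _ _ _ _ (H O)).
    + exists 1%R. split; [lra|]. intros z _. now rewrite csum_O.
    + intros i _. now rewrite csum_O.
  - refine (expands_ext _ _ _ _ _ _ _ (expands_plus _ _ _ _ _ IH (H (S M)))).
    + exists 1%R. split; [lra|]. intros z _. now rewrite csum_S.
    + intros i _. now rewrite csum_S.
Qed.

Lemma bigO_comp N (g h : C -> C) : bigO N g -> bigO 1 h -> bigO N (fun z => g (h z)).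
Proof.
  intros (K & HK & r & Hr & Hg) (L & HL & Hh).
  exists (K * L ^ N)%R. split; [apply Rmult_le_pos; [exact HK | now apply pow_le]|].
  assert (Hs : (0 < r / (L + 1))%R) by (apply Rdiv_lt_0_compat; lra).
  refine (near0_imp _ _ _ (near0_and _ _ Hh (near0_lt _ Hs))). intros z [H1 H2].
  rewrite pow_1 in H1.
  assert (H3 : (Cmod (h z) < r)%R).
  { apply Rle_lt_trans with (1 := H1).
    apply Rle_lt_trans with (L * (r / (L + 1)))%R.
    - apply Rmult_le_compat_l; lra.
    - apply (Rmult_lt_reg_r (L + 1)); [lra|].
      replace (L * (r / (L + 1)) * (L + 1))%R with (L * r)%R by (field; lra). nra. }
  eapply Rle_trans; [exact (Hg _ H3)|]. rewrite Rmult_assoc.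
  apply Rmult_le_compat_l; [exact HK|]. rewrite <- Rpow_mult_distr.
  apply pow_incr. split; [apply Cmod_ge_0 | exact H1].
Qed.

Lemma expands_comp N (g h : C -> C) a b :
  b O = 0 -> expands N g a -> expands N h b ->
  expands N (fun z => g (h z)) (fps_comp a b).
Proof.
  intros Hb0 Ha Hb.
  assert (Hh : bigO 1 h).
  { apply (expands_bigO N h b); [lia| |exact Hb]. intros i Hi.
    replace i with O by lia. exact Hb0. }
  assert (H1 := bigO_comp _ _ _ Ha Hh).
  assert (H2 : expands N (fun z => psum a N (h z)) (fps_comp a b)).
  { refine (expands_ext _ _ _ _ _ _ _
      (expands_csum N N _ _ (fun m => expands_scal N (a m) _ _ (expands_pow N h b m Hb)))).
    - exists 1%R. split; [lra | reflexivity].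
    - intros i Hi. rewrite fps_compE. clear -Hi Hb0. induction N as [|N IH].
      + now replace i with O by lia.
      + destruct (Nat.eq_dec i (S N)) as [->|Hne]; [reflexivity|].
        rewrite csum_S, IH by lia. destruct (fps_pow_low b (S N) Hb0) as [Hl _].
        rewrite Hl by lia. ring. }
  refine (bigO_ext' _ _ _ _ (bigO_plus _ _ _ H1 H2)). intros z. cbv beta. ring.
Qed.

(** A polynomial of degree at most [N] that is [o(z^N)] vanishes: its lowest
    coefficient is tested on small positive reals. *)
Lemma psum_little_o d N :
  (forall eps : R, (0 < eps)%R ->
     near0 (fun z => (Cmod (psum d N z) <= eps * Cmod z ^ N)%R)) ->
  forall n, (n <= N)%nat -> d n = 0.
Proof.
  intros H n. induction n as [n IH] using lt_wf_ind. intros Hn.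
  apply Cmod_eq_0, Rle_antisym; [|apply Cmod_ge_0].
  apply le_epsilon. intros eps Heps. rewrite Rplus_0_l.
  set (D := rpsum (cabs d) N 1).
  assert (HD : (0 <= D)%R) by (apply rpsum_nonneg; lra).
  assert (Hs : (0 < eps / 2 / (D + 1))%R) by (repeat apply Rdiv_lt_0_compat; lra).
  destruct (near0_and _ _ (H (eps / 2)%R ltac:(lra))
             (near0_and _ _ (near0_lt _ Hs) (near0_lt 1 ltac:(lra)))) as (r & Hr & Hz).
  specialize (Hz (RtoC (r / 2))).
  set (x := (r / 2)%R) in *.
  assert (Hx : (0 < x)%R) by (unfold x; lra).
  assert (Ex : Cmod (RtoC x) = x) by (rewrite Cmod_R, Rabs_right; lra).
  rewrite Ex in Hz. destruct Hz as (H1 & H2 & H3); [unfold x; lra|].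
  assert (H4 := psum_tail d 1 x (RtoC x) n N ltac:(lra) ltac:(lra) ltac:(lra) Hn).
  assert (E : psum d n (RtoC x) = d n * RtoC x ^ n).
  { unfold psum. rewrite (csum_single _ _ n); [reflexivity | lia|].
    intros i Hi Hne. rewrite IH by lia. ring. }
  rewrite E in H4.
  assert (H5 : (Cmod (d n) * x ^ n <= eps / 2 * x ^ N + x ^ S n * D)%R).
  { replace (Cmod (d n) * x ^ n)%R with (Cmod (d n * RtoC x ^ n)).
    2:{ rewrite Cmod_mult, Cmod_pow, Ex. reflexivity. }
    replace (d n * RtoC x ^ n)
      with (psum d N (RtoC x) + - (psum d N (RtoC x) - d n * RtoC x ^ n)) by ring.
    eapply Rle_trans; [apply Cmod_triangle|]. rewrite Cmod_opp.
    assert (H6 := rpsum_nonneg d n 1 ltac:(lra)).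
    assert (H7 : (0 <= x ^ S n)%R) by (apply pow_le; lra).
    fold D in H4. nra. }
  assert (Hxn : (0 < x ^ n)%R) by now apply pow_lt.
  assert (H6 : (x ^ N <= x ^ n)%R).
  { replace N with (n + (N - n))%nat by lia. rewrite pow_add.
    rewrite <- (Rmult_1_r (x ^ n)) at 2. apply Rmult_le_compat_l; [lra|].
    rewrite <- (pow1 (N - n)). apply pow_incr; lra. }
  assert (H7 : (x * D <= eps / 2)%R).
  { apply Rle_trans with (eps / 2 / (D + 1) * D)%R.
    - apply Rmult_le_compat_r; lra.
    - apply (Rmult_le_reg_r (D + 1)); [lra|].
      replace (eps / 2 / (D + 1) * D * (D + 1))%R with (eps / 2 * D)%R by (field; lra).
      nra. }
  apply (Rmult_le_reg_r (x ^ n)); [exact Hxn|]. cbn [pow] in H5. nra.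
Qed.

Lemma bigO_little N (g : C -> C) (eps : R) :
  (0 < eps)%R -> bigO (S N) g -> near0 (fun z => (Cmod (g z) <= eps * Cmod z ^ N)%R).
Proof.
  intros Heps (K & HK & Hg).
  assert (Hs : (0 < eps / (K + 1))%R) by (apply Rdiv_lt_0_compat; lra).
  refine (near0_imp _ _ _ (near0_and _ _ Hg (near0_lt _ Hs))). intros z [H1 H2].
  eapply Rle_trans; [exact H1|]. cbn [pow]. rewrite <- Rmult_assoc.
  apply Rmult_le_compat_r; [apply pow_le, Cmod_ge_0|].
  apply Rle_trans with (K * (eps / (K + 1)))%R.
  - apply Rmult_le_compat_l; lra.
  - apply (Rmult_le_reg_r (K + 1)); [lra|].
    replace (K * (eps / (K + 1)) * (K + 1))%R with (K * eps)%R by (field; lra). nra.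
Qed.

Lemma psum_minus a b N z : psum (fun n => a n - b n) N z = psum a N z - psum b N z.
Proof. unfold psum. rewrite <- csum_minus. apply csum_ext; intros; ring. Qed.

Lemma expands_unique_little N (g h : C -> C) a b :
  (forall eps : R, (0 < eps)%R ->
     near0 (fun z => (Cmod (g z - h z) <= eps * Cmod z ^ N)%R)) ->
  expands N g a -> expands N h b -> forall n, (n <= N)%nat -> a n = b n.
Proof.
  intros H Ha Hb n Hn. apply Ceq_minus.
  apply (psum_little_o (fun i => a i - b i) N); [|exact Hn].
  intros eps Heps.
  assert (Heps' : (0 < eps / 3)%R) by lra.
  refine (near0_imp _ _ _ (near0_and _ _ (H _ Heps')
    (near0_and _ _ (bigO_little _ _ _ Heps' Ha) (bigO_little _ _ _ Heps' Hb)))).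
  intros z (H1 & H2 & H3). rewrite psum_minus.
  replace (psum a N z - psum b N z)
    with ((g z - h z) + (- (g z - psum a N z) + (h z - psum b N z))) by ring.
  eapply Rle_trans; [apply Cmod_triangle|].
  assert (H4 := Cmod_triangle (- (g z - psum a N z)) (h z - psum b N z)).
  rewrite Cmod_opp in H4. lra.
Qed.

Lemma expands_unique N (g : C -> C) a b :
  expands N g a -> expands N g b -> forall n, (n <= N)%nat -> a n = b n.
Proof.
  apply expands_unique_little. intros eps Heps. exists 1%R. split; [lra|].
  intros z _. replace (g z - g z) with (RtoC 0) by ring. rewrite Cmod_0.
  apply Rmult_le_pos; [lra | apply pow_le, Cmod_ge_0].
Qed.

(** Both sides expand the same composite of three polynomial functions, for which
    associativity is trivial. *)
Lemma fps_comp_assoc a b c :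
  b O = 0 -> c O = 0 -> fps_comp (fps_comp a b) c = fps_comp a (fps_comp b c).
Proof.
  intros Hb Hc. apply functional_extensionality. intros n.
  assert (Ha := expands_psum a n). assert (Hb' := expands_psum b n).
  assert (Hc' := expands_psum c n).
  apply (expands_unique n (fun z => psum a n (psum b n (psum c n z)))); [| |lia].
  - apply (expands_comp n (fun w => psum a n (psum b n w)) (psum c n)); auto.
    apply (expands_comp n (psum a n) (psum b n)); auto.
  - apply (expands_comp n (psum a n) (fun w => psum b n (psum c n w))); auto.
    + now rewrite fps_comp_O.
    + apply (expands_comp n (psum b n) (psum c n)); auto.
Qed.

Lemma pow_n_Cpow (z : C) n : @pow_n C_AbsRing z n = z ^ n.
Proof. induction n as [|n IH]; [reflexivity|]. cbn. now rewrite <- IH. Qed.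

Lemma is_pseries_C a (z l : C) :
  @is_pseries C_AbsRing C_NormedModule a z l <->
  forall eps : R, (0 < eps)%R ->
    exists N0, forall N, (N0 <= N)%nat -> (Cmod (psum a N z - l) < eps)%R.
Proof.
  unfold is_pseries, is_series.
  assert (E : forall N, sum_n (fun k => @scal C_AbsRing C_NormedModule (pow_n z k) (a k)) N
                        = psum a N z).
  { intros N. apply (csum_ext (fun k => @pow_n C_AbsRing z k * a k)). intros i _.
    rewrite pow_n_Cpow. apply Cmult_comm. }
  split.
  - intros H eps Heps.
    destruct (H (fun y => Cmod (y - l) < eps)%R) as [N0 HN].
    + apply (locally_C l). exists (mkposreal eps Heps). intros y Hy. exact Hy.
    + exists N0. intros N HN0. specialize (HN N HN0). now rewrite E in HN.
  - intros H P HP. apply (locally_C l) in HP. destruct HP as [eps HP].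
    destruct (H eps (cond_pos eps)) as [N0 HN]. exists N0. intros N HN0.
    apply HP. rewrite E. exact (HN N HN0).
Qed.

Lemma has_series_C (g : C -> C) a :
  has_series g a <->
  near0 (fun z => forall eps : R, (0 < eps)%R ->
    exists N0, forall N, (N0 <= N)%nat -> (Cmod (psum a N z - g z) < eps)%R).
Proof.
  unfold has_series. rewrite locally_near0.
  split; apply near0_imp; intros z H; now apply is_pseries_C.
Qed.

(** The terms of a series converging at some [s > 0] are bounded there, so that
    at radius [s / 2] its tails are dominated by geometric ones. *)
Lemma has_series_expands (g : C -> C) a N : has_series g a -> expands N g a.
Proof.
  rewrite has_series_C. intros (r & Hr & H).
  set (s := (r / 2)%R). assert (Hs : (0 < s)%R) by (unfold s; lra).
  assert (Es : Cmod (RtoC s) = s) by (rewrite Cmod_R, Rabs_right; lra).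
  destruct (H (RtoC s)) with (eps := 1%R) as [N0 HN0]; [rewrite Es; unfold s; lra | lra|].
  assert (HM : exists M, (0 <= M)%R /\ forall n, (cabs a n * s ^ n <= M)%R).
  { exists (rpsum (cabs a) N0 s + 2)%R.
    assert (HP := rpsum_nonneg a N0 s ltac:(lra)). split; [lra|]. intros n.
    destruct (le_lt_dec n N0) as [Hn|Hn].
    - assert (H1 := rsum_mono (fun i => cabs a i * s ^ i)%R n N0 Hn
                      (fun i _ => rpsum_term_nonneg a s i ltac:(lra))).
      assert (H2 : (cabs a n * s ^ n <= rpsum (cabs a) n s)%R).
      { destruct n as [|n]; [rewrite rpsum_O; cbn [pow]; lra|]. rewrite rpsum_S.
        assert (H3 := rpsum_nonneg a n s ltac:(lra)). lra. }
      unfold rpsum in *. lra.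
    - destruct n as [|n]; [lia|].
      assert (H1 := HN0 (S n) ltac:(lia)). assert (H2 := HN0 n ltac:(lia)).
      assert (H3 : Cmod (a (S n) * RtoC s ^ S n) = (cabs a (S n) * s ^ S n)%R).
      { rewrite Cmod_mult, Cmod_pow, Es. reflexivity. }
      rewrite <- H3.
      replace (a (S n) * RtoC s ^ S n)
        with ((psum a (S n) (RtoC s) - g (RtoC s)) + - (psum a n (RtoC s) - g (RtoC s)))
        by (rewrite psum_S; ring).
      eapply Rle_trans; [apply Cmod_triangle|]. rewrite Cmod_opp. lra. }
  destruct HM as (M & HM0 & HM).
  exists (2 * M / s ^ S N)%R. split.
  { apply Rdiv_le_0_compat; [lra | now apply pow_lt]. }
  exists (s / 2)%R. split; [lra|]. intros z Hz.
  apply le_epsilon. intros eps Heps.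
  destruct (H z) with (eps := eps) as [N1 HN1]; [unfold s in *; lra | exact Heps|].
  set (n := Nat.max N1 N).
  assert (H1 := HN1 n ltac:(lia)).
  set (x := (Cmod z / s)%R).
  assert (Hx : (0 <= x <= 1 / 2)%R).
  { unfold x. split.
    - apply Rdiv_le_0_compat; [apply Cmod_ge_0 | lra].
    - apply (Rmult_le_reg_r s); [lra|].
      replace (Cmod z / s * s)%R with (Cmod z) by (field; lra). lra. }
  assert (Ez : Cmod z = (x * s)%R) by (unfold x; field; lra).
  assert (Htail : forall m, (Cmod (psum a (N + m) z - psum a N z)
                  <= M * x ^ S N * (2 - 2 * (1 / 2) ^ m))%R).
  { induction m as [|m IH].
    - rewrite Nat.add_0_r. replace (psum a N z - psum a N z) with (RtoC 0) by ring.
      rewrite Cmod_0. cbn [pow]. lra.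
    - rewrite Nat.add_succ_r, psum_S.
      replace (psum a (N + m) z + a (S (N + m)) * z ^ S (N + m) - psum a N z)
        with ((psum a (N + m) z - psum a N z) + a (S (N + m)) * z ^ S (N + m)) by ring.
      eapply Rle_trans; [apply Cmod_triangle|].
      assert (H2 : (Cmod (a (S (N + m)) * z ^ S (N + m)) <= M * x ^ S N * (1 / 2) ^ m)%R).
      { rewrite Cmod_mult, Cmod_pow, Ez, Rpow_mult_distr.
        replace (Cmod (a (S (N + m))) * (x ^ S (N + m) * s ^ S (N + m)))%R
          with ((cabs a (S (N + m)) * s ^ S (N + m)) * x ^ S (N + m))%R
          by (unfold cabs; ring).
        rewrite (Rmult_assoc M). apply Rmult_le_compat; auto.
        - apply rpsum_term_nonneg; lra.
        - apply pow_le; lra.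
        - change (S (N + m)) with (S N + m)%nat. rewrite pow_add.
          apply Rmult_le_compat_l; [apply pow_le; lra|]. apply pow_incr; lra. }
      cbn [pow]. cbn [pow] in H2, IH. lra. }
  assert (H2 := Htail (n - N)%nat). replace (N + (n - N))%nat with n in H2 by lia.
  assert (H3 : (Cmod (psum a n z - psum a N z) <= 2 * M / s ^ S N * Cmod z ^ S N)%R).
  { eapply Rle_trans; [exact H2|]. rewrite Ez, Rpow_mult_distr.
    replace (2 * M / s ^ S N * (x ^ S N * s ^ S N))%R with (M * x ^ S N * 2)%R
      by (field; apply pow_nonzero; lra).
    apply Rmult_le_compat_l.
    - apply Rmult_le_pos; [exact HM0 | apply pow_le; lra].
    - assert (H4 : (0 <= (1 / 2) ^ (n - N))%R) by (apply pow_le; lra). lra. }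
  replace (g z - psum a N z) with (- (psum a n z - g z) + (psum a n z - psum a N z)) by ring.
  eapply Rle_trans; [apply Cmod_triangle|]. rewrite Cmod_opp. lra.
Qed.

(** * Recursively defined sequences *)

Fixpoint rec_prefix {T : Type} (d : T) (step : nat -> (nat -> T) -> T) (n : nat)
  : nat -> T :=
  match n with
  | O => fun _ => d
  | S n' => fun m => if (m =? n')%nat then step n' (rec_prefix d step n')
                     else rec_prefix d step n' m
  end.

Lemma strong_recursion {T : Type} (d : T) (step : nat -> (nat -> T) -> T) :
  exists y : nat -> T,
    forall n, y n = step n (fun m => if (m <? n)%nat then y m else d).
Proof.
  exists (fun n => rec_prefix d step (S n) n). intros n.
  cbn [rec_prefix]. rewrite Nat.eqb_refl. f_equal.
  apply functional_extensionality. intros m.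
  induction n as [|n IH]; [reflexivity|]. cbn [rec_prefix].
  destruct (Nat.eqb_spec m n) as [->|Hne].
  - rewrite (proj2 (Nat.ltb_lt n (S n))) by lia. now rewrite Nat.eqb_refl.
  - rewrite IH. destruct (Nat.ltb_spec m n).
    + now rewrite (proj2 (Nat.ltb_lt m (S n))) by lia.
    + now rewrite (proj2 (Nat.ltb_ge m (S n))) by lia.
Qed.

(** * Formal conjugacy of parabolic series *)

Lemma csum_delta (k n : nat) (x : C) :
  (k <= n)%nat -> csum (fun i => if (i =? k)%nat then x else 0) n = x.
Proof.
  intros Hk. rewrite (csum_single _ _ k Hk).
  - now rewrite Nat.eqb_refl.
  - intros i _ Hi. apply Nat.eqb_neq in Hi. now rewrite Hi.
Qed.

Lemma fps_pow_1 h n : fps_pow h 1 n = h n.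
Proof.
  cbn [fps_pow]. rewrite fps_mulE, (csum_single _ _ n); [|lia|].
  - rewrite Nat.sub_diag. ring.
  - intros i Hi Hne. destruct (n - i)%nat eqn:E; [lia | ring].
Qed.

Definition parabolic_form (k : nat) (p : C) (P : nat -> C) : Prop :=
  P O = 0 /\ P 1%nat = 1 /\ (forall i, (2 <= i <= k)%nat -> P i = 0)
  /\ P (k + 1)%nat = p.

(** Here [P] is the perturbation of the identity in degree [k + 1]. *)
Lemma fps_pow_parabolic k p (P : nat -> C) m :
  (1 <= k)%nat -> parabolic_form k p P ->
  (forall n, (n < m + k)%nat -> fps_pow P m n = if (n =? m)%nat then 1 else 0)
  /\ fps_pow P m (m + k) = RtoC (INR m) * p.
Proof.
  intros Hk (P0 & P1 & Pi & Pk).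
  assert (H0 : 1 * fps_id 0 = 0) by (unfold fps_id; cbn; ring).
  assert (Hag : forall i, (i < k + 1)%nat -> P i = 1 * fps_id i).
  { intros i Hi. unfold fps_id. destruct (Nat.eqb_spec i 1) as [->|Hne].
    - rewrite P1. ring.
    - destruct i as [|i]; [rewrite P0 | rewrite Pi by lia]; ring. }
  destruct (fps_pow_perturb P (fun i => 1 * fps_id i) (k + 1) m P0 H0 ltac:(lia) Hag)
    as [H1 H2].
  split.
  - intros n Hn. rewrite H1 by lia. rewrite fps_pow_scale, Cpow_1_l. reflexivity.
  - specialize (H2 ltac:(lia) (m + k)%nat ltac:(lia)).
    rewrite fps_pow_scale, P1, !Cpow_1_l, Pk in H2.
    replace (m + k =? m)%nat with false in H2.
    2:{ symmetry. apply Nat.eqb_neq. lia. }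
    unfold fps_id in H2. replace (k + 1 =? 1)%nat with false in H2.
    2:{ symmetry. apply Nat.eqb_neq. lia. }
    replace (fps_pow P m (m + k)) with (fps_pow P m (m + k) - 0) by ring.
    rewrite H2. ring.
Qed.

Definition defect (P Q h : nat -> C) (n : nat) : C :=
  fps_comp h P n - fps_comp Q h n.

Lemma fps_comp_sub_l h h' (P : nat -> C) n :
  fps_comp h P n - fps_comp h' P n = csum (fun m => (h m - h' m) * fps_pow P m n) n.
Proof.
  rewrite !fps_compE, <- csum_minus. apply csum_ext; intros; ring.
Qed.

(** Up to degree [k] both series are the identity; in degree [k + 1] only the
    leading terms compete, which fixes [h_1^k]. *)
Lemma defect_low k (p q : C) (P Q h : nat -> C) :
  (1 <= k)%nat -> parabolic_form k p P -> parabolic_form k q Q -> h O = 0 ->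
  (forall n, (n <= k)%nat -> defect P Q h n = 0)
  /\ defect P Q h (k + 1) = h 1%nat * p - q * h 1%nat ^ (k + 1).
Proof.
  intros Hk HP (Q0 & Q1 & Qi & Qk) H0.
  assert (HQ : forall n m, (m <= k)%nat ->
            Q m * fps_pow h m n = if (m =? 1)%nat then h n else 0).
  { intros n m Hm. destruct (Nat.eqb_spec m 1) as [->|Hne].
    - rewrite fps_pow_1, Q1. ring.
    - destruct m as [|m]; [rewrite Q0 | rewrite Qi by lia]; ring. }
  assert (HPm : forall n m, (1 <= m)%nat -> (n < m + k)%nat ->
            h m * fps_pow P m n = if (m =? n)%nat then h n else 0).
  { intros n m Hm Hn. destruct (fps_pow_parabolic k p P m Hk HP) as [H1 _].
    rewrite H1 by exact Hn. rewrite Nat.eqb_sym.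
    destruct (Nat.eqb_spec m n) as [->|_]; ring. }
  unfold defect. split.
  - intros n Hn. rewrite !fps_compE. destruct n as [|n].
    + rewrite !csum_O, H0, Q0. ring.
    + rewrite (csum_ext _ (fun m => if (m =? S n)%nat then h (S n) else 0)).
      2:{ intros i Hi. destruct i as [|i]; [rewrite H0; cbn; ring|]. apply HPm; lia. }
      rewrite csum_delta by lia.
      rewrite (csum_ext _ (fun m => if (m =? 1)%nat then h (S n) else 0)).
      2:{ intros i Hi. apply HQ. lia. }
      rewrite csum_delta by lia. ring.
  - rewrite !fps_compE. replace (k + 1)%nat with (S k) by lia.
    rewrite (csum_S (fun m => Q m * fps_pow h m (S k))).
    rewrite (csum_ext (fun m => Q m * fps_pow h m (S k))
              (fun m => if (m =? 1)%nat then h (S k) else 0)).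
    2:{ intros i Hi. apply HQ. lia. }
    rewrite csum_delta by lia.
    rewrite (csum_ext _ (fun m => (if (m =? 1)%nat then h 1%nat * p else 0)
                                  + (if (m =? S k)%nat then h (S k) else 0))).
    + rewrite csum_plus, !csum_delta by lia.
      destruct (fps_pow_low h (S k) H0) as [_ E]. rewrite E.
      replace (S k) with (k + 1)%nat by lia. rewrite Qk. ring.
    + intros i Hi. destruct i as [|[|i]].
      * rewrite H0. cbn. ring.
      * rewrite fps_pow_1. destruct HP as (_ & _ & _ & Pk).
        replace (S k) with (k + 1)%nat by lia. rewrite Pk.
        replace (1 =? k + 1)%nat with false by (symmetry; apply Nat.eqb_neq; lia).
        cbn [Nat.eqb]. ring.
      * rewrite HPm by lia. cbn [Nat.eqb]. ring.
Qed.

(** The linearised conjugacy equation: its degree [k + j] part is diagonal in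
    the coefficient of degree [j], with the resonance [j = k + 1]. *)
Lemma defect_perturb k (p q : C) (P Q h h' : nat -> C) j :
  (1 <= k)%nat -> parabolic_form k p P -> parabolic_form k q Q ->
  h O = 0 -> h' O = 0 -> (2 <= j)%nat -> (forall i, (i < j)%nat -> h i = h' i) ->
  p = q * h 1%nat ^ k ->
  defect P Q h (k + j) - defect P Q h' (k + j)
  = (RtoC (INR j) - RtoC (INR (k + 1))) * p * (h j - h' j).
Proof.
  intros Hk HP (Q0 & Q1 & Qi & Qk) H0 H0' Hj Hag Hp.
  unfold defect.
  replace (fps_comp h P (k + j) - fps_comp Q h (k + j)
           - (fps_comp h' P (k + j) - fps_comp Q h' (k + j)))
    with ((fps_comp h P (k + j) - fps_comp h' P (k + j))
          - (fps_comp Q h (k + j) - fps_comp Q h' (k + j))) by ring.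
  set (n := (k + j)%nat).
  assert (E1 : fps_comp h P n - fps_comp h' P n
               = RtoC (INR j) * p * (h j - h' j) + (h n - h' n)).
  { rewrite fps_comp_sub_l.
    rewrite (csum_ext _ (fun m => (if (m =? j)%nat then RtoC (INR j) * p * (h j - h' j) else 0)
                                  + (if (m =? n)%nat then h n - h' n else 0))).
    - rewrite csum_plus, !csum_delta by (unfold n; lia). reflexivity.
    - intros m Hm. destruct (fps_pow_parabolic k p P m Hk HP) as [H1 H2].
      destruct (lt_dec m j) as [Hlt|Hge].
      + rewrite Hag by exact Hlt.
        replace (m =? j)%nat with false by (symmetry; apply Nat.eqb_neq; lia).
        replace (m =? n)%nat with false by (symmetry; apply Nat.eqb_neq; unfold n; lia).
        ring.
      + destruct (Nat.eqb_spec m j) as [->|Hne].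
        * replace (j =? n)%nat with false by (symmetry; apply Nat.eqb_neq; unfold n; lia).
          replace n with (j + k)%nat by (unfold n; lia). rewrite H2. ring.
        * rewrite H1 by (unfold n; lia). rewrite Nat.eqb_sym.
          destruct (Nat.eqb_spec m n) as [->|_]; ring. }
  assert (E2 : fps_comp Q h n - fps_comp Q h' n
               = (h n - h' n) + RtoC (INR (k + 1)) * p * (h j - h' j)).
  { rewrite !fps_compE, <- csum_minus.
    rewrite (csum_ext _ (fun m => (if (m =? 1)%nat then h n - h' n else 0)
              + (if (m =? k + 1)%nat then RtoC (INR (k + 1)) * p * (h j - h' j) else 0))).
    - rewrite csum_plus, !csum_delta by (unfold n; lia). reflexivity.
    - intros m Hm.
      destruct (fps_pow_perturb h h' j m H0 H0' ltac:(lia) Hag) as [H1 H2].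
      destruct (Nat.eqb_spec m 1) as [->|Hm1].
      { replace (1 =? k + 1)%nat with false by (symmetry; apply Nat.eqb_neq; lia).
        rewrite !fps_pow_1, Q1. ring. }
      destruct (Nat.eqb_spec m (k + 1)) as [->|Hmk].
      { specialize (H2 Hj n ltac:(unfold n; lia)). rewrite Qk, Hp.
        replace (k + 1 - 1)%nat with k in H2 by lia.
        transitivity (q * (fps_pow h (k + 1) n - fps_pow h' (k + 1) n)); [ring|].
        rewrite H2. ring. }
      destruct m as [|m]; [rewrite Q0; ring|].
      destruct (le_lt_dec (S m) k) as [Hle|Hlt].
      + rewrite Qi by lia. ring.
      + rewrite H1 by (unfold n; lia). ring. }
  rewrite E1, E2. ring.
Qed.

Lemma RtoC_INR_sub_neq0 i j : i <> j -> RtoC (INR i) - RtoC (INR j) <> 0.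
Proof.
  intros H E. apply Ceq_minus, RtoC_inj, INR_eq in E. contradiction.
Qed.

(** Away from the resonance every coefficient of a conjugacy is determined by the
    ones below it. *)
Lemma conjugacy_unique k (p q : C) (P Q h h' : nat -> C) J :
  (1 <= k)%nat -> p <> 0 -> parabolic_form k p P -> parabolic_form k q Q ->
  h O = 0 -> h' O = 0 -> p = q * h 1%nat ^ k -> h 1%nat = h' 1%nat ->
  ((k + 1 < J)%nat -> h (k + 1)%nat = h' (k + 1)%nat) ->
  (forall j, (2 <= j < J)%nat -> defect P Q h (k + j) = defect P Q h' (k + j)) ->
  forall j, (j < J)%nat -> h j = h' j.
Proof.
  intros Hk Hp0 HP HQ H0 H0' Hp H1 Hres Hdef j.
  induction j as [j IH] using lt_wf_ind. intros HjJ.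
  destruct j as [|[|j]]; [congruence | exact H1|].
  destruct (Nat.eq_dec (S (S j)) (k + 1)) as [Hr|Hr].
  { rewrite Hr. apply Hres. lia. }
  assert (E := defect_perturb k p q P Q h h' (S (S j)) Hk HP HQ H0 H0' ltac:(lia)
                 (fun i Hi => IH i Hi ltac:(lia)) Hp).
  rewrite (Hdef (S (S j))) in E by lia.
  apply Ceq_minus.
  destruct (Ceq_dec (h (S (S j)) - h' (S (S j))) 0) as [Hz|Hz]; [exact Hz|].
  exfalso. refine (Cmult_neq_0 _ _ (Cmult_neq_0 _ _ (RtoC_INR_sub_neq0 _ _ Hr) Hp0) Hz _).
  rewrite <- E. ring.
Qed.

(** In the degrees above [2 k + 1], that is, past the resonance, the linearised
    equation determines each new coefficient. *)
Lemma conjugacy_extend k (p q : C) (P Q g : nat -> C) :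
  (1 <= k)%nat -> p <> 0 -> parabolic_form k p P -> parabolic_form k q Q ->
  g O = 0 -> p = q * g 1%nat ^ k ->
  (forall j, (2 <= j <= k + 1)%nat -> defect P Q g (k + j) = 0) ->
  exists h : nat -> C, (forall i, (i <= k + 1)%nat -> h i = g i) /\ fps_comp h P = fps_comp Q h.
Proof.
  intros Hk Hp0 HP HQ Hg0 Hp Hg.
  pose (coef := fun j => (RtoC (INR j) - RtoC (INR (k + 1))) * p).
  destruct (strong_recursion (RtoC 0) (fun j h =>
     if (j <=? k + 1)%nat then g j else - defect P Q h (k + j) / coef j)) as [h Hh].
  assert (Hhg : forall i, (i <= k + 1)%nat -> h i = g i).
  { intros i Hi. rewrite Hh. now rewrite (proj2 (Nat.leb_le _ _) Hi). }
  exists h. split; [exact Hhg|]. apply functional_extensionality. intros n.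
  apply Ceq_minus. fold (defect P Q h n).
  assert (H0 : h O = 0) by (rewrite Hhg by lia; exact Hg0).
  assert (H1 : h 1%nat = g 1%nat) by (apply Hhg; lia).
  destruct (defect_low k p q P Q h Hk HP HQ H0) as [L1 L2].
  destruct (le_lt_dec n k) as [Hn|Hn]; [now apply L1|].
  destruct (Nat.eq_dec n (k + 1)) as [->|Hn1].
  { rewrite L2, Hp, H1, Nat.add_1_r, Cpow_S. ring. }
  set (j := (n - k)%nat). replace n with (k + j)%nat by (unfold j; lia).
  assert (Hj : (2 <= j)%nat) by (unfold j; lia).
  rewrite <- H1 in Hp.
  destruct (le_lt_dec j (k + 1)) as [Hjk|Hjk].
  - assert (E := defect_perturb k p q P Q h g j Hk HP HQ H0 Hg0 Hj
                   (fun i Hi => Hhg i ltac:(lia)) Hp).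
    rewrite Hg, (Hhg j) in E by lia.
    replace (defect P Q h (k + j)) with (defect P Q h (k + j) - 0) by ring.
    rewrite E. ring.
  - set (h' := fun m => if (m <? j)%nat then h m else 0).
    assert (Ej : h j = - defect P Q h' (k + j) / coef j).
    { rewrite Hh at 1. now rewrite (proj2 (Nat.leb_gt _ _) Hjk). }
    assert (E := defect_perturb k p q P Q h h' j Hk HP HQ H0).
    unfold h' at 1 in E. rewrite (proj2 (Nat.ltb_lt 0 j)) in E by lia.
    specialize (E H0 Hj).
    replace (h' j) with (RtoC 0) in E.
    2:{ unfold h'. now rewrite Nat.ltb_irrefl. }
    assert (Hc : coef j <> 0).
    { apply Cmult_neq_0; [apply RtoC_INR_sub_neq0; lia | exact Hp0]. }
    replace (defect P Q h (k + j))
      with ((defect P Q h (k + j) - defect P Q h' (k + j)) + defect P Q h' (k + j)) by ring.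
    rewrite E; [|intros i Hi; unfold h'; now rewrite (proj2 (Nat.ltb_lt i j)) by exact Hi
                |exact Hp].
    fold (coef j). rewrite Ej. field. exact Hc.
Qed.

(** The coefficient of [z^(2k+1)] is an invariant of series [z + z^(k+1) +
    beta z^(2k+1) + ...]: below the resonance the conjugacy must be linear. *)
Lemma residue_invariant k (P Q h : nat -> C) :
  (1 <= k)%nat -> parabolic_form k 1 P -> parabolic_form k 1 Q ->
  (forall i, (k + 2 <= i <= 2 * k)%nat -> P i = 0 /\ Q i = 0) ->
  h O = 0 -> h 1%nat <> 0 -> fps_comp h P = fps_comp Q h ->
  P (2 * k + 1)%nat = Q (2 * k + 1)%nat.
Proof.
  intros Hk HP HQ Hgap H0 H1 Hconj.
  assert (Hdef : forall n, defect P Q h n = 0).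
  { intros n. unfold defect. rewrite Hconj. ring. }
  destruct (defect_low k 1 1 P Q h Hk HP HQ H0) as [_ L].
  rewrite Hdef, Nat.add_1_r, Cpow_S in L.
  set (l := h 1%nat) in *.
  assert (Hl : l ^ k = 1).
  { apply Ceq_minus. destruct (Ceq_dec (l ^ k - 1) 0) as [E|E]; [exact E|].
    exfalso. apply (Cmult_neq_0 _ _ H1 E).
    replace (l * (l ^ k - 1)) with (- (l * 1 - 1 * (l * l ^ k))) by ring.
    rewrite <- L. ring. }
  (* Compare [h] with its linear part. *)
  set (h' := fun i => l * fps_id i).
  assert (H0' : h' O = 0) by (unfold h', fps_id; cbn; ring).
  assert (H1' : l = h' 1%nat) by (unfold h', fps_id; cbn; ring).
  assert (Hdef' : forall n, defect P Q h' n = l * P n - Q n * l ^ n).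
  { intros n. unfold defect. unfold h'. rewrite fps_comp_scale_r, fps_comp_scale_l; auto.
    exact (proj1 HP). }
  assert (Hp : RtoC 1 = 1 * l ^ k) by (rewrite Hl; ring).
  assert (Hag : forall i, (i < k + 1)%nat -> h i = h' i).
  { apply (conjugacy_unique k 1 1 P Q); auto using C1_nz; [lia|].
    intros j Hj. rewrite Hdef, Hdef'.
    destruct (Nat.eq_dec j (k + 1)) as [->|Hne]; [lia|].
    destruct (Hgap (k + j)%nat ltac:(lia)) as [-> ->]. ring. }
  assert (E := defect_perturb k 1 1 P Q h h' (k + 1) Hk HP HQ H0 H0' ltac:(lia) Hag Hp).
  rewrite Hdef, Hdef' in E.
  replace (k + (k + 1))%nat with (2 * k + 1)%nat in E by lia.
  replace (l ^ (2 * k + 1)%nat) with l in E.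
  2:{ replace (2 * k + 1)%nat with (S (k + k)) by lia. rewrite Cpow_S, Cpow_add_r, Hl. ring. }
  apply Ceq_minus.
  destruct (Ceq_dec (P (2 * k + 1)%nat - Q (2 * k + 1)%nat) 0) as [Hz|Hz]; [exact Hz|].
  exfalso. apply (Cmult_neq_0 _ _ H1 Hz).
  transitivity (- (0 - (l * P (2 * k + 1)%nat - Q (2 * k + 1)%nat * l))); [ring|].
  rewrite E. ring.
Qed.

(** Composition with [h] on the right is triangular with diagonal [h_1 ^ n]. *)
Lemma fps_comp_right_top (a a' h : nat -> C) n :
  h O = 0 -> (forall i, (i < n)%nat -> a i = a' i) ->
  fps_comp a h n - fps_comp a' h n = (a n - a' n) * h 1%nat ^ n.
Proof.
  intros H0 Hag. rewrite fps_comp_sub_l, (csum_single _ _ n); [|lia|].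
  - now rewrite (proj2 (fps_pow_low h n H0)).
  - intros i Hi Hne. rewrite Hag by lia. ring.
Qed.

Lemma fps_comp_cancel_r (a a' h : nat -> C) :
  h O = 0 -> h 1%nat <> 0 -> fps_comp a h = fps_comp a' h -> a = a'.
Proof.
  intros H0 H1 E. apply functional_extensionality. intros n.
  induction n as [n IH] using lt_wf_ind.
  assert (T := fps_comp_right_top a a' h n H0 IH). rewrite E in T.
  apply Ceq_minus. destruct (Ceq_dec (a n - a' n) 0) as [Hz|Hz]; [exact Hz|].
  exfalso. apply (Cmult_neq_0 _ _ Hz (Cpow_nz _ n H1)). rewrite <- T. ring.
Qed.

Lemma fps_comp_divide (h0 h1 : nat -> C) :
  h0 O = 0 -> h0 1%nat <> 0 -> exists h : nat -> C, fps_comp h h0 = h1.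
Proof.
  intros H0 H1.
  destruct (strong_recursion (RtoC 0) (fun n h =>
     (h1 n - fps_comp h h0 n) / h0 1%nat ^ n)) as [h Hh].
  exists h. apply functional_extensionality. intros n.
  set (h' := fun m => if (m <? n)%nat then h m else 0).
  assert (Hn : h n = (h1 n - fps_comp h' h0 n) / h0 1%nat ^ n) by apply Hh.
  assert (T := fps_comp_right_top h h' h0 n H0).
  replace (h' n) with (RtoC 0) in T.
  2:{ unfold h'. now rewrite Nat.ltb_irrefl. }
  replace (fps_comp h h0 n)
    with ((fps_comp h h0 n - fps_comp h' h0 n) + fps_comp h' h0 n) by ring.
  rewrite T, Hn.
  - field. now apply Cpow_nz.
  - intros i Hi. unfold h'. now rewrite (proj2 (Nat.ltb_lt i n)) by exact Hi.
Qed.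

(** The conjugacy is [h1] composed with the inverse of [h0], which exists as a
    quotient because composition on the right is triangular. *)
Lemma conjugacy_quotient (F P Q h0 h1 : nat -> C) :
  F O = 0 -> P O = 0 -> h0 O = 0 -> h0 1%nat <> 0 -> h1 O = 0 -> h1 1%nat <> 0 ->
  fps_comp h0 F = fps_comp P h0 -> fps_comp h1 F = fps_comp Q h1 ->
  exists h : nat -> C, h O = 0 /\ h 1%nat <> 0 /\ fps_comp h P = fps_comp Q h.
Proof.
  intros HF HP H00 H01 H10 H11 E0 E1.
  destruct (fps_comp_divide h0 h1 H00 H01) as [h Hh].
  assert (Hh0 : h O = 0) by (rewrite <- (fps_comp_O h h0), Hh; exact H10).
  exists h. split; [exact Hh0|]. split.
  - intros Hz. apply H11. rewrite <- Hh, fps_comp_1 by exact H00. rewrite Hz. ring.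
  - apply (fps_comp_cancel_r _ _ h0 H00 H01).
    rewrite !fps_comp_assoc; auto.
    rewrite <- E0, <- fps_comp_assoc; auto. now rewrite Hh.
Qed.

(** Compositional square roots tangent to the identity are unique. Here [D] stands
    for [h o A] and [E] for [V o h], where [h] conjugates [A o A] to [V o V]. In the
    first degree where [D] and [E] could differ, one equation gives
    [D_n - E_n] the value of its opposite, because [A] and [V] have linear part
    [z]. *)
Lemma square_root_cancel (A V D E : nat -> C) :
  A O = 0 -> A 1%nat = 1 -> V O = 0 -> V 1%nat = 1 -> D O = 0 -> E O = 0 ->
  fps_comp D A = fps_comp V E -> fps_comp E A = fps_comp V D -> D = E.
Proof.
  intros A0 A1 V0 V1 D0 E0 HD HE. apply functional_extensionality. intros n.
  induction n as [n IH] using lt_wf_ind.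
  destruct n as [|n]; [congruence|].
  assert (T1 := fps_comp_right_top D E A (S n) A0 IH).
  rewrite A1, Cpow_1_l, HD, HE in T1.
  assert (T2 : fps_comp V D (S n) - fps_comp V E (S n) = D (S n) - E (S n)).
  { rewrite !fps_compE, <- csum_minus.
    rewrite (csum_single _ _ 1); [rewrite !fps_pow_1, V1; ring | lia|].
    intros m Hm Hne. destruct m as [|m]; [cbn; ring|].
    destruct (fps_pow_perturb D E (S n) (S m) D0 E0 ltac:(lia) IH) as [H _].
    rewrite H by lia. ring. }
  assert (H2 : RtoC 2 * (D (S n) - E (S n)) = 0).
  { transitivity ((fps_comp V D (S n) - fps_comp V E (S n))
                  + (fps_comp V E (S n) - fps_comp V D (S n))); [|ring].
    rewrite T1, T2. ring. }
  apply Ceq_minus. destruct (Ceq_dec (D (S n) - E (S n)) 0) as [Hz|Hz]; [exact Hz|].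
  exfalso. apply (fun H => Cmult_neq_0 _ _ H Hz H2).
  intros H. apply RtoC_inj in H. lra.
Qed.

Lemma parabolic_square k (p : C) (P : nat -> C) :
  (1 <= k)%nat -> parabolic_form k p P -> parabolic_form k (2 * p) (fps_comp P P).
Proof.
  intros Hk HP. assert (HP' := HP). destruct HP' as (P0 & P1 & Pi & Pk).
  assert (Hn : forall n, (n <= k + 1)%nat ->
            fps_comp P P n = P n + (if (n =? k + 1)%nat then p else 0)).
  { intros n Hn. rewrite fps_compE. destruct n as [|n].
    { rewrite csum_O, P0. replace (0 =? k + 1)%nat with false; [ring|].
      symmetry. apply Nat.eqb_neq. lia. }
    rewrite (csum_ext _ (fun m => (if (m =? 1)%nat then P (S n) else 0)
        + (if (m =? S n)%nat then (if (S n =? k + 1)%nat then p else 0) else 0))).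
    - rewrite csum_plus, !csum_delta by lia. reflexivity.
    - intros m Hm. destruct m as [|[|m]].
      + rewrite P0. cbn. ring.
      + rewrite fps_pow_1, P1. change (1 =? 1)%nat with true. cbv iota.
        destruct (Nat.eqb_spec 1 (S n)) as [<-|_]; [|ring].
        replace (1 =? k + 1)%nat with false; [ring|]. symmetry. apply Nat.eqb_neq. lia.
      + change (S (S m) =? 1)%nat with false. cbv iota.
        destruct (Nat.eqb_spec (S (S m)) (S n)) as [E|E].
        * rewrite <- E. destruct (Nat.eqb_spec (S (S m)) (k + 1)) as [E'|E'].
          -- rewrite E', Pk. rewrite (proj2 (fps_pow_low P (k + 1) P0)), P1, Cpow_1_l. ring.
          -- rewrite Pi by lia. ring.
        * rewrite Pi by lia. ring. }
  repeat split.
  - now rewrite fps_comp_O.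
  - rewrite fps_comp_1, P1 by exact P0. ring.
  - intros i Hi. rewrite Hn, Pi by lia.
    replace (i =? k + 1)%nat with false; [ring|]. symmetry. apply Nat.eqb_neq. lia.
  - rewrite Hn, Nat.eqb_refl, Pk by lia. ring.
Qed.

(** In degree [2 k + 1] the cross term comes from the derivative of
    [p z^(k+1)] in the direction [p z^(k+1)]. *)
Lemma parabolic_square_residue k (p : C) (P : nat -> C) :
  (1 <= k)%nat -> parabolic_form k p P ->
  (forall i, (k + 2 <= i <= 2 * k)%nat -> P i = 0) ->
  (forall i, (k + 2 <= i <= 2 * k)%nat -> fps_comp P P i = 0)
  /\ fps_comp P P (2 * k + 1)%nat
     = 2 * P (2 * k + 1)%nat + RtoC (INR (k + 1)) * p ^ 2.
Proof.
  intros Hk HP Hgap. assert (HP' := HP). destruct HP' as (P0 & P1 & Pi & Pk).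
  destruct (fps_pow_parabolic k p P (k + 1) Hk HP) as [HL1 HL2].
  assert (Hn : forall n, (k + 2 <= n <= 2 * k + 1)%nat ->
            fps_comp P P n = P n + p * fps_pow P (k + 1) n
                             + (if (n =? 2 * k + 1)%nat then P n else 0)).
  { intros n Hn. rewrite fps_compE.
    rewrite (csum_ext _ (fun m => (if (m =? 1)%nat then P n else 0)
        + (if (m =? k + 1)%nat then p * fps_pow P (k + 1) n else 0)
        + (if (m =? n)%nat then (if (n =? 2 * k + 1)%nat then P n else 0) else 0))).
    - rewrite !csum_plus, !csum_delta by lia. reflexivity.
    - intros m Hm. destruct (Nat.eqb_spec m 1) as [->|H1].
      { replace (1 =? k + 1)%nat with false by (symmetry; apply Nat.eqb_neq; lia).
        replace (1 =? n)%nat with false by (symmetry; apply Nat.eqb_neq; lia).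
        rewrite fps_pow_1, P1. ring. }
      destruct (Nat.eqb_spec m (k + 1)) as [->|H2].
      { replace (k + 1 =? n)%nat with false by (symmetry; apply Nat.eqb_neq; lia).
        rewrite Pk. ring. }
      destruct (Nat.eqb_spec m n) as [->|H3].
      { rewrite (proj2 (fps_pow_low P n P0)), P1, Cpow_1_l.
        destruct (Nat.eqb_spec n (2 * k + 1)) as [E|E]; [ring|].
        rewrite Hgap by lia. ring. }
      replace (P m) with (RtoC 0); [ring|]. symmetry.
      destruct m as [|m]; [exact P0|].
      destruct (le_lt_dec (S m) k); [apply Pi | apply Hgap]; lia. }
  split.
  - intros i Hi. rewrite Hn, HL1, Hgap by lia.
    replace (i =? k + 1)%nat with false by (symmetry; apply Nat.eqb_neq; lia).
    replace (i =? 2 * k + 1)%nat with false by (symmetry; apply Nat.eqb_neq; lia).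
    ring.
  - rewrite Hn, Nat.eqb_refl by lia.
    replace (fps_pow P (k + 1) (2 * k + 1)) with (fps_pow P (k + 1) (k + 1 + k))
      by (f_equal; lia).
    rewrite HL2. ring.
Qed.

Lemma real_root k (r : R) :
  (1 <= k)%nat -> r <> 0%R -> (Nat.Even k -> (0 < r)%R) ->
  exists m : R, m <> 0%R /\ (m ^ k = r)%R.
Proof.
  intros Hk Hr He.
  assert (Hpos : forall x, (0 < x)%R -> exists m, (0 < m)%R /\ (m ^ k = x)%R).
  { intros x Hx. exists (Rpower x (/ INR k)). split; [apply exp_pos|].
    rewrite <- Rpower_pow by apply exp_pos. rewrite Rpower_mult, Rinv_l.
    - now apply Rpower_1.
    - apply not_0_INR. lia. }
  destruct (Rlt_le_dec 0 r) as [H|H].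
  - destruct (Hpos r H) as (m & Hm & E). exists m. split; [lra | exact E].
  - destruct (Nat.Even_or_Odd k) as [Hev|[j Hj]]; [specialize (He Hev); lra|].
    destruct (Hpos (- r)%R ltac:(lra)) as (m & Hm & E).
    exists (- m)%R. split; [lra|].
    replace (- m)%R with (-1 * m)%R by ring. rewrite Rpow_mult_distr, E.
    rewrite Hj, Nat.add_1_r, pow_1_odd. ring.
Qed.

(** The coefficientwise form of [v (l z) = l v (z)]; it holds for [z] times a
    series in [z^k]. *)
Definition rotation_invariant (k : nat) (v : nat -> C) : Prop :=
  forall (l : C) n, l ^ k = 1 -> v n * l ^ n = l * v n.

(** The formal part of the theorem: [A] is the real form of [a], [g] the normal
    form of [a o abar], and [v] the half-time map. *)
Lemma formal_classification k (b : C) (r : R) (a A g v h0 h1 : nat -> C) :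
  (1 <= k)%nat -> r <> 0%R -> (Nat.Even k -> (0 < r)%R) ->
  a O = 0 -> h0 O = 0 -> h0 1%nat <> 0 -> h1 O = 0 -> h1 1%nat <> 0 ->
  fps_conj A = A -> parabolic_form k (RtoC r) A ->
  fps_comp h0 a = fps_comp A (fps_conj h0) ->
  parabolic_form k 1 g -> (forall i, (k + 2 <= i <= 2 * k)%nat -> g i = 0) ->
  g (2 * k + 1)%nat = RtoC (INR (k + 1) / 2) - b ->
  fps_comp h1 (fps_comp a (fps_conj a)) = fps_comp g h1 ->
  rotation_invariant k v -> parabolic_form k (/ 2) v ->
  (forall i, (k + 2 <= i <= 2 * k)%nat -> v i = 0) ->
  v (2 * k + 1)%nat = RtoC (INR (k + 1) / 8) - b / 2 ->
  (Cconj b = b -> fps_conj v = v) ->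
  formally_conjugate_antiseries a (fps_conj v).
Proof.
  intros Hk Hr Hev Ha0 H00 H01 H10 H11 HAr HA E0 Hg Hggap Hgres E1 Hrot Hv Hvgap Hvres Hvr.
  assert (A0 : A O = 0) by exact (proj1 HA). assert (v0 : v O = 0) by exact (proj1 Hv).
  assert (g0 : g O = 0) by exact (proj1 Hg).
  assert (H00c : fps_conj h0 O = 0) by (unfold fps_conj; rewrite H00; apply Cconj_RtoC).
  assert (Ha0c : fps_conj a O = 0) by (unfold fps_conj; rewrite Ha0; apply Cconj_RtoC).
  set (AA := fps_comp A A). set (W := fps_comp v v).
  assert (HAA := parabolic_square k _ A Hk HA). fold AA in HAA.
  assert (HW := parabolic_square k _ v Hk Hv). fold W in HW.
  destruct (parabolic_square_residue k _ v Hk Hv Hvgap) as [HWgap HWres]. fold W in HWgap, HWres.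
  assert (H2 : RtoC 2 <> 0) by (intros H; apply RtoC_inj in H; lra).
  replace (2 * / 2) with (RtoC 1) in HW by (field; exact H2).
  assert (HWg : W (2 * k + 1)%nat = g (2 * k + 1)%nat).
  { rewrite HWres, Hvres, Hgres. rewrite !RtoC_div by lra.
    field. }
  (* The holomorphic square of [a] becomes [A A], which is therefore conjugate to [g]. *)
  assert (E0' : fps_comp h0 (fps_comp a (fps_conj a)) = fps_comp AA h0).
  { rewrite <- fps_comp_assoc, E0, fps_comp_assoc by auto.
    rewrite <- fps_conj_comp, E0, fps_conj_comp, fps_conj_invol, HAr.
    unfold AA. now rewrite fps_comp_assoc. }
  destruct (conjugacy_quotient (fps_comp a (fps_conj a)) AA g h0 h1) as (h & Hh0 & Hh1 & Eh);
    auto.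
  { now rewrite fps_comp_O. }
  { exact (proj1 HAA). }
  assert (HAAr : fps_conj AA = AA) by (unfold AA; now rewrite fps_conj_comp, HAr).
  assert (Ehc : fps_comp (fps_conj h) AA = fps_comp (fps_conj g) (fps_conj h)).
  { rewrite <- HAAr, <- !fps_conj_comp. now rewrite Eh. }
  assert (Hh0c : fps_conj h O = 0) by (unfold fps_conj; rewrite Hh0; apply Cconj_RtoC).
  assert (Hh1c : fps_conj h 1%nat <> 0).
  { intros H. apply Hh1. rewrite <- (Cconj_conj (h 1%nat)). unfold fps_conj in H.
    rewrite H. apply Cconj_RtoC. }
  (* [g] is conjugate to its complex conjugate, so that [b] is real. *)
  assert (Hb : Cconj b = b).
  { destruct (conjugacy_quotient AA g (fps_conj g) h (fps_conj h)) as (u & Hu0 & Hu1 & Eu);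
      auto.
    { exact (proj1 HAA). }
    assert (Hgc : parabolic_form k 1 (fps_conj g)).
    { destruct Hg as (G0 & G1 & Gi & Gk). unfold fps_conj. repeat split.
      - rewrite G0. apply Cconj_RtoC.
      - rewrite G1. apply Cconj_RtoC.
      - intros i Hi. rewrite Gi by exact Hi. apply Cconj_RtoC.
      - rewrite Gk. apply Cconj_RtoC. }
    assert (E : g (2 * k + 1)%nat = fps_conj g (2 * k + 1)%nat).
    { apply (residue_invariant k g (fps_conj g) u); auto.
      intros i Hi. unfold fps_conj. rewrite Hggap by exact Hi. split; auto using Cconj_RtoC. }
    unfold fps_conj in E. rewrite Hgres, Cminus_conj, Cconj_RtoC in E.
    transitivity (RtoC (INR (k + 1) / 2) - (RtoC (INR (k + 1) / 2) - Cconj b)); [ring|].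
    rewrite <- E. ring. }
  specialize (Hvr Hb). rewrite Hvr.
  assert (HWr : fps_conj W = W) by (unfold W; now rewrite fps_conj_comp, Hvr).
  (* [g] and [v v] agree past the resonance. *)
  destruct (conjugacy_extend k 1 1 g W (fun i => 1 * fps_id i)) as (h2 & Hh2 & E2);
    auto using C1_nz.
  { unfold fps_id. cbn. ring. }
  { unfold fps_id. cbn [Nat.eqb]. replace (1 * 1) with (RtoC 1) by ring. rewrite Cpow_1_l. ring. }
  { intros j Hj. unfold defect. rewrite fps_comp_scale_r, fps_comp_scale_l, Cpow_1_l by exact g0.
    destruct (Nat.eq_dec j (k + 1)) as [->|Hne].
    - replace (k + (k + 1))%nat with (2 * k + 1)%nat by lia. rewrite HWg. ring.
    - rewrite Hggap, HWgap by lia. ring. }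
  assert (h20 : h2 O = 0) by (rewrite Hh2 by lia; unfold fps_id; cbn; ring).
  assert (h21 : h2 1%nat = 1) by (rewrite Hh2 by lia; unfold fps_id; cbn; ring).
  set (h3 := fps_comp h2 h).
  assert (h30 : h3 O = 0) by (unfold h3; now rewrite fps_comp_O).
  assert (W0 : W O = 0) by exact (proj1 HW).
  assert (AA0 : AA O = 0) by exact (proj1 HAA).
  assert (h31 : h3 1%nat <> 0).
  { unfold h3. rewrite fps_comp_1, h21 by exact Hh0. now rewrite Cmult_1_l. }
  assert (E3 : fps_comp h3 AA = fps_comp W h3).
  { unfold h3. rewrite fps_comp_assoc, Eh, <- fps_comp_assoc, E2, fps_comp_assoc by auto.
    reflexivity. }
  assert (Hlead : h3 1%nat ^ k = 2 * RtoC r).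
  { destruct (defect_low k _ _ AA W h3 Hk HAA HW h30) as [_ L].
    unfold defect in L. rewrite E3, Nat.add_1_r, Cpow_S in L.
    apply Ceq_minus. destruct (Ceq_dec (h3 1%nat ^ k - 2 * RtoC r) 0) as [E|E]; [exact E|].
    exfalso. apply (Cmult_neq_0 _ _ h31 E).
    transitivity (- (h3 1%nat * (2 * RtoC r) - 1 * (h3 1%nat * h3 1%nat ^ k))); [ring|].
    rewrite <- L. ring. }
  (* Rotate the linear part onto the real axis. *)
  destruct (real_root k (2 * r) Hk) as (m & Hm0 & Hm); [lra| |].
  { intros H. specialize (Hev H). lra. }
  set (l := RtoC m / h3 1%nat).
  assert (Hl : l ^ k = 1).
  { unfold l, Cdiv. rewrite Cpow_mult_l, Cpow_inv, <- RtoC_pow, Hm, Hlead, RtoC_mult by exact h31.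
    apply Cinv_r. rewrite <- RtoC_mult. intros H. apply RtoC_inj in H. lra. }
  set (L := fun i => l * fps_id i).
  assert (L0 : L O = 0) by (unfold L, fps_id; cbn; ring).
  assert (HvL : fps_comp L v = fps_comp v L).
  { apply functional_extensionality. intros n. unfold L.
    rewrite fps_comp_scale_l, fps_comp_scale_r by exact v0. now rewrite Hrot. }
  assert (HWL : fps_comp L W = fps_comp W L).
  { unfold W. rewrite <- fps_comp_assoc, HvL, fps_comp_assoc, HvL, <- fps_comp_assoc by auto.
    reflexivity. }
  set (h4 := fps_comp L h3).
  assert (h40 : h4 O = 0) by (unfold h4; now rewrite fps_comp_O).
  assert (h41 : h4 1%nat = RtoC m).
  { unfold h4, L. rewrite fps_comp_scale_l by exact h30. unfold l. field. exact h31. }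
  assert (E4 : fps_comp h4 AA = fps_comp W h4).
  { unfold h4. rewrite fps_comp_assoc, E3, <- fps_comp_assoc, HWL, fps_comp_assoc by auto.
    reflexivity. }
  assert (Hp0 : 2 * RtoC r <> 0).
  { rewrite <- RtoC_mult. intros H. apply RtoC_inj in H. lra. }
  assert (Hp : 2 * RtoC r = 1 * RtoC m ^ k) by (rewrite <- RtoC_pow, Hm, RtoC_mult; ring).
  (* The resonant coefficient may be replaced by [0]; with it and the linear
     part real, uniqueness makes the whole conjugacy real. *)
  set (g5 := fun i => if (i <=? k)%nat then h4 i else 0).
  assert (g50 : g5 O = 0) by exact h40.
  assert (g51 : g5 1%nat = RtoC m).
  { unfold g5. now rewrite (proj2 (Nat.leb_le 1 k) Hk). }
  destruct (conjugacy_extend k (2 * RtoC r) 1 AA W g5) as (h5 & Hh5 & E5); auto.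
  { now rewrite g51. }
  { intros j Hj.
    assert (E := defect_perturb k (2 * RtoC r) 1 AA W h4 g5 j Hk HAA HW h40 g50 ltac:(lia)).
    rewrite h41 in E. specialize (fun H => E H Hp).
    assert (D4 : forall n, defect AA W h4 n = 0) by (intros n; unfold defect; rewrite E4; ring).
    rewrite D4 in E.
    transitivity (- (0 - defect AA W g5 (k + j))); [ring|]. rewrite E.
    - destruct (Nat.eq_dec j (k + 1)) as [->|Hne]; [ring|].
      unfold g5. rewrite (proj2 (Nat.leb_le j k)) by lia. ring.
    - intros i Hi. unfold g5. now rewrite (proj2 (Nat.leb_le i k)) by lia. }
  assert (h50 : h5 O = 0) by (rewrite Hh5 by lia; exact g50).
  assert (h51 : h5 1%nat = RtoC m) by (rewrite Hh5 by lia; exact g51).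
  assert (h5k : h5 (k + 1)%nat = 0).
  { rewrite Hh5 by lia. unfold g5. now rewrite (proj2 (Nat.leb_gt (k + 1) k)) by lia. }
  assert (E5c : fps_comp (fps_conj h5) AA = fps_comp W (fps_conj h5)).
  { rewrite <- HAAr, <- HWr, <- !fps_conj_comp. now rewrite E5. }
  assert (h5r : fps_conj h5 = h5).
  { apply functional_extensionality. intros n. symmetry.
    apply (conjugacy_unique k (2 * RtoC r) 1 AA W h5 (fps_conj h5) (S n)); auto.
    - unfold fps_conj. rewrite h50. apply Cconj_RtoC.
    - now rewrite h51.
    - unfold fps_conj. rewrite h51. symmetry. apply Cconj_RtoC.
    - intros _. unfold fps_conj. rewrite h5k. symmetry. apply Cconj_RtoC.
    - intros j Hj. unfold defect. rewrite E5, E5c. ring. }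
  (* A conjugacy of the squares is one of the square roots. *)
  assert (E6 : fps_comp h5 A = fps_comp v h5).
  { destruct HA as (_ & A1 & _). destruct Hv as (_ & v1 & _).
    apply (square_root_cancel A v); auto.
    - now rewrite fps_comp_O.
    - rewrite fps_comp_assoc by auto. fold AA. rewrite E5. unfold W.
      now rewrite fps_comp_assoc.
    - now rewrite fps_comp_assoc by auto. }
  split; [exact Ha0|]. split; [exact v0|].
  exists (fps_comp h5 h0). split; [now rewrite fps_comp_O|]. split.
  - rewrite fps_comp_1, h51 by exact H00. apply Cmult_neq_0; [|exact H01].
    intros H. apply RtoC_inj in H. contradiction.
  - intros n. change (fun j => Cconj (fps_comp h5 h0 j)) with (fps_conj (fps_comp h5 h0)).
    rewrite fps_conj_comp, h5r, fps_comp_assoc, E0 by auto.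
    rewrite <- fps_comp_assoc, E6, fps_comp_assoc by auto. reflexivity.
Qed.

(** * Complex-valued functions of a real variable *)

Definition cderiv (f : R -> C) (t : R) (l : C) : Prop :=
  is_derive (fun s => Re (f s)) t (Re l) /\ is_derive (fun s => Im (f s)) t (Im l).

Lemma is_derive_cderiv (f : R -> C) t l :
  @is_derive R_AbsRing C_R_NormedModule f t l -> cderiv f t l.
Proof.
  intros H. split.
  - eapply filterdiff_ext_lin.
    + apply (filterdiff_comp' f (fst : C_R_NormedModule -> R)).
      * exact H.
      * apply filterdiff_linear, is_linear_fst.
    + reflexivity.
  - eapply filterdiff_ext_lin.
    + apply (filterdiff_comp' f (snd : C_R_NormedModule -> R)).
      * exact H.
      * apply filterdiff_linear, is_linear_snd.
    + reflexivity.
Qed.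

Lemma cderiv_eq (f : R -> C) t l l' : l = l' -> cderiv f t l -> cderiv f t l'.
Proof. now intros <-. Qed.

Lemma cderiv_const (c : C) t : cderiv (fun _ => c) t 0.
Proof. split; apply (is_derive_const (K := R_AbsRing) (V := R_NormedModule)). Qed.

Lemma cderiv_plus (f g : R -> C) t l m :
  cderiv f t l -> cderiv g t m -> cderiv (fun s => f s + g s) t (l + m).
Proof.
  intros [H1 H2] [H3 H4]. split.
  - exact (is_derive_plus _ _ _ _ _ H1 H3).
  - exact (is_derive_plus _ _ _ _ _ H2 H4).
Qed.

Lemma is_derive_eq (f : R -> R) (t l l' : R) :
  l = l' -> is_derive f t l -> is_derive f t l'.
Proof. now intros <-. Qed.

Lemma is_derive_Rplus (f g : R -> R) (t l m : R) :
  is_derive f t l -> is_derive g t m -> is_derive (fun s => f s + g s)%R t (l + m)%R.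
Proof. intros H1 H2. exact (is_derive_plus f g t l m H1 H2). Qed.

Lemma is_derive_Rminus (f g : R -> R) (t l m : R) :
  is_derive f t l -> is_derive g t m -> is_derive (fun s => f s - g s)%R t (l - m)%R.
Proof. intros H1 H2. exact (is_derive_minus f g t l m H1 H2). Qed.

Lemma is_derive_Rmult (f g : R -> R) (t l m : R) :
  is_derive f t l -> is_derive g t m ->
  is_derive (fun s => f s * g s)%R t (l * g t + f t * m)%R.
Proof. intros H1 H2. exact (is_derive_mult f g t l m H1 H2 Rmult_comm). Qed.

Lemma cderiv_mult (f g : R -> C) t l m :
  cderiv f t l -> cderiv g t m -> cderiv (fun s => f s * g s) t (l * g t + f t * m).
Proof.
  intros [H1 H2] [H3 H4]. split.
  - apply (is_derive_ext (fun s => Re (f s) * Re (g s) - Im (f s) * Im (g s))%R).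
    { intros s. symmetry. apply re_mult. }
    eapply is_derive_eq; [|apply is_derive_Rminus; apply is_derive_Rmult; eassumption].
    rewrite re_plus, !re_mult. ring.
  - apply (is_derive_ext (fun s => Re (f s) * Im (g s) + Im (f s) * Re (g s))%R).
    { intros s. symmetry. apply im_mult. }
    eapply is_derive_eq; [|apply is_derive_Rplus; apply is_derive_Rmult; eassumption].
    rewrite im_plus, !im_mult. ring.
Qed.

Lemma cderiv_scal (c : C) (f : R -> C) t l :
  cderiv f t l -> cderiv (fun s => c * f s) t (c * l).
Proof.
  intros H. refine (cderiv_eq _ _ _ _ _ (cderiv_mult _ _ _ _ _ (cderiv_const c t) H)). ring.
Qed.

Lemma cderiv_minus (f g : R -> C) t l m :
  cderiv f t l -> cderiv g t m -> cderiv (fun s => f s - g s) t (l - m).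
Proof.
  intros [H1 H2] [H3 H4]. split.
  - exact (is_derive_minus _ _ _ _ _ H1 H3).
  - exact (is_derive_minus _ _ _ _ _ H2 H4).
Qed.

Lemma cderiv_conj (f : R -> C) t l :
  cderiv f t l -> cderiv (fun s => Cconj (f s)) t (Cconj l).
Proof.
  intros [H1 H2]. split; [exact H1|]. exact (is_derive_opp _ _ _ H2).
Qed.

Lemma cderiv_csum (f : nat -> R -> C) t (l : nat -> C) N :
  (forall n, (n <= N)%nat -> cderiv (f n) t (l n)) ->
  cderiv (fun s => csum (fun n => f n s) N) t (csum l N).
Proof.
  induction N as [|N IH]; intros H.
  - rewrite csum_O.
    replace (fun s => csum (fun n => f n s) 0) with (f O); [auto|].
    apply functional_extensionality. intros s. now rewrite csum_O.
  - rewrite csum_S.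
    replace (fun s => csum (fun n => f n s) (S N))
      with (fun s => csum (fun n => f n s) N + f (S N) s).
    + apply cderiv_plus; auto.
    + apply functional_extensionality. intros s. now rewrite csum_S.
Qed.

Lemma cderiv_psum (f : nat -> R -> C) t (l : nat -> C) N (w : C) :
  (forall n, (n <= N)%nat -> cderiv (f n) t (l n)) ->
  cderiv (fun s => psum (fun n => f n s) N w) t (psum l N w).
Proof.
  intros H. apply (cderiv_csum (fun n s => f n s * w ^ n)). intros n Hn.
  refine (cderiv_eq _ _ _ _ _ (cderiv_mult _ _ _ _ _ (H n Hn) (cderiv_const (w ^ n) t))).
  ring.
Qed.

Lemma cderiv_pow (f : R -> C) t l n (Y : C) :
  l = f t * Y -> cderiv f t l ->
  cderiv (fun s => f s ^ n) t (RtoC (INR n) * f t ^ n * Y).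
Proof.
  intros Hl H. induction n as [|n IH].
  - cbn [Cpow]. refine (cderiv_eq _ _ _ _ _ (cderiv_const 1 t)). cbn [INR]. ring.
  - refine (cderiv_eq _ _ _ _ _ (cderiv_mult _ _ _ _ _ H IH)).
    rewrite Hl, S_INR, RtoC_plus, Cpow_S. ring.
Qed.

Lemma cderiv_inv (f : R -> C) t l :
  f t <> 0 -> cderiv f t l -> cderiv (fun s => / f s) t (- l / (f t * f t)).
Proof.
  intros Hf [H1 H2].
  assert (Hn : (Re (f t) * Re (f t) + Im (f t) * Im (f t))%R <> 0%R).
  { intros E. apply Hf. destruct (f t) as [x y]. cbn in E.
    assert (x = 0%R) by nra. assert (y = 0%R) by nra. now subst. }
  assert (Hd := is_derive_Rplus _ _ _ _ _ (is_derive_Rmult _ _ _ _ _ H1 H1)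
                  (is_derive_Rmult _ _ _ _ _ H2 H2)).
  split.
  - apply (is_derive_ext (fun s => (Re (f s) / (Re (f s) * Re (f s) + Im (f s) * Im (f s)))%R)).
    { intros s. unfold Cinv, Re, Im. cbn. now rewrite !Rmult_1_r. }
    refine (is_derive_eq _ _ _ _ _ (is_derive_div _ _ _ _ _ H1 Hd Hn)).
    destruct (f t) as [x y], l as [l1 l2]. unfold plus, Cdiv, Cinv, Cmult, Copp in *.
    cbn in *. field. split; [|nra].
    replace ((x * x - y * y) * (x * x - y * y) + (x * y + y * x) * (x * y + y * x))%R
      with ((x * x + y * y) * (x * x + y * y))%R by ring.
    now apply Rmult_integral_contrapositive_currified.
  - apply (is_derive_ext (fun s => (- Im (f s) / (Re (f s) * Re (f s) + Im (f s) * Im (f s)))%R)).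
    { intros s. unfold Cinv, Re, Im. cbn. now rewrite !Rmult_1_r. }
    refine (is_derive_eq _ _ _ _ _ (is_derive_div _ _ _ _ _ (is_derive_opp _ _ _ H2) Hd Hn)).
    destruct (f t) as [x y], l as [l1 l2]. unfold plus, opp, Cdiv, Cinv, Cmult, Copp in *.
    cbn in *. field. split; [|nra].
    replace ((x * x - y * y) * (x * x - y * y) + (x * y + y * x) * (x * y + y * x))%R
      with ((x * x + y * y) * (x * x + y * y))%R by ring.
    now apply Rmult_integral_contrapositive_currified.
Qed.

Lemma is_derive_continuous (f : R -> R) (t l : R) : is_derive f t l -> continuous f t.
Proof. intros H. apply (ex_derive_continuous (V := R_NormedModule) f t). now exists l. Qed.

Lemma cderiv_bounded (f : R -> C) (T : R) :
  (0 <= T)%R -> (forall t, (0 <= t <= T)%R -> exists l, cderiv f t l) ->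
  exists M, (0 <= M)%R /\ forall t, (0 <= t <= T)%R -> (Cmod (f t) <= M)%R.
Proof.
  intros HT H.
  destruct (bounded_continuity (fun t => Re (f t)) 0 T) as [M1 H1].
  { intros t Ht. destruct (H t Ht) as [l [Hl _]]. exact (is_derive_continuous _ _ _ Hl). }
  destruct (bounded_continuity (fun t => Im (f t)) 0 T) as [M2 H2].
  { intros t Ht. destruct (H t Ht) as [l [_ Hl]]. exact (is_derive_continuous _ _ _ Hl). }
  assert (Hb : forall t, (0 <= t <= T)%R -> (Cmod (f t) <= M1 + M2)%R).
  { intros t Ht. specialize (H1 t Ht). specialize (H2 t Ht).
    change (norm (Re (f t))) with (Rabs (Re (f t))) in H1.
    change (norm (Im (f t))) with (Rabs (Im (f t))) in H2.
    replace (f t) with (RtoC (Re (f t)) + Ci * RtoC (Im (f t))).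
    2:{ destruct (f t) as [x y]. unfold Ci, RtoC, Cplus, Cmult, Re, Im. cbn. f_equal; ring. }
    eapply Rle_trans; [apply Cmod_triangle|].
    rewrite Cmod_mult, Cmod_Ci, !Cmod_R. lra. }
  exists (M1 + M2)%R. split; [|exact Hb].
  eapply Rle_trans; [apply (Cmod_ge_0 (f 0%R))|]. apply Hb. lra.
Qed.

(** An approximate solution of a linear equation with small data stays small:
    the derivative of [|delta|^2] is at most [(2 M + 1) |delta|^2 + eps^2]. *)
Lemma gronwall (M eps : R) (delta H e : R -> C) :
  (0 <= M)%R -> (0 <= eps)%R ->
  (forall t, (0 <= t <= 1 / 2)%R ->
     cderiv delta t (H t * delta t + e t)
     /\ (Cmod (H t) <= M)%R /\ (Cmod (e t) <= eps)%R) ->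
  forall t, (0 <= t <= 1 / 2)%R ->
    (Cmod (delta t) <= exp (2 * M + 1) * (Cmod (delta 0%R) + eps))%R.
Proof.
  intros HM Heps Hd t Ht.
  set (L := (2 * M + 1)%R).
  set (N := fun s => (Re (delta s) * Re (delta s) + Im (delta s) * Im (delta s))%R).
  assert (HN : forall s, N s = (Cmod (delta s) ^ 2)%R).
  { intros s. rewrite Cmod2_alt. unfold N. ring. }
  (* [phi] is nonincreasing, which is the integrated form of the estimate. *)
  set (phi := fun s => (N s * exp (- L * s) - eps ^ 2 * s)%R).
  set (l := fun s => H s * delta s + e s).
  set (dN := fun s => (2 * (Re (delta s) * Re (l s) + Im (delta s) * Im (l s)))%R).
  set (dphi := fun s => ((dN s - L * N s) * exp (- L * s) - eps ^ 2)%R).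
  assert (Hphi : forall s, (0 <= s <= 1 / 2)%R -> is_derive phi s (dphi s)).
  { intros s Hs. destruct (Hd s Hs) as [[H1 H2] _]. fold (l s) in H1, H2.
    assert (HE : is_derive (fun x => exp (- L * x)) s (- L * exp (- L * s))%R).
    { auto_derive; [exact I|]. ring. }
    assert (HI : is_derive (fun x => (eps ^ 2 * x)%R) s (eps ^ 2)%R).
    { auto_derive; [exact I|]. ring. }
    assert (HN' := is_derive_Rplus _ _ _ _ _ (is_derive_Rmult _ _ _ _ _ H1 H1)
                     (is_derive_Rmult _ _ _ _ _ H2 H2)).
    refine (is_derive_eq _ _ _ _ _ (is_derive_Rminus _ _ _ _ _
              (is_derive_Rmult _ _ _ _ _ HN' HE) HI)).
    unfold dphi, dN, N. ring. }
  assert (Hneg : forall s, (0 <= s <= 1 / 2)%R -> (dphi s <= 0)%R).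
  { intros s Hs. destruct (Hd s Hs) as (_ & H3 & H4).
    assert (HdN : (dN s <= 2 * (Cmod (delta s) * Cmod (l s)))%R).
    { assert (E : (dN s = 2 * Re (Cconj (delta s) * l s))%R).
      { rewrite re_mult, re_conj, im_conj. unfold dN. ring. }
      rewrite E, <- (Cmod_conj (delta s)), <- Cmod_mult.
      assert (H5 := re_le_Cmod (Cconj (delta s) * l s)).
      assert (H6 := Rle_abs (Re (Cconj (delta s) * l s))). lra. }
    assert (Hl : (Cmod (l s) <= M * Cmod (delta s) + eps)%R).
    { unfold l. eapply Rle_trans; [apply Cmod_triangle|]. rewrite Cmod_mult.
      apply Rplus_le_compat; [|exact H4].
      apply Rmult_le_compat_r; [apply Cmod_ge_0 | exact H3]. }
    assert (H5 := Cmod_ge_0 (delta s)). set (D := Cmod (delta s)) in *.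
    assert (H6 : (D * Cmod (l s) <= D * (M * D + eps))%R) by now apply Rmult_le_compat_l.
    assert (H7 : (dN s - L * N s <= eps ^ 2)%R).
    { rewrite HN. fold D. unfold L.
      assert (H8 := pow2_ge_0 (D - eps)). nra. }
    assert (H8 : (0 < exp (- L * s) <= 1)%R).
    { split; [apply exp_pos|]. rewrite <- exp_0.
      destruct (Req_dec (- L * s) 0) as [->|Hne]; [lra|].
      apply Rlt_le, exp_increasing. unfold L in *. nra. }
    assert (H9 := pow2_ge_0 eps). unfold dphi. nra. }
  assert (Hle : (phi t <= phi 0)%R).
  { destruct (MVT_gen phi 0 t dphi) as (c & Hc & E).
    - intros x Hx. rewrite Rmin_left, Rmax_right in Hx by lra. apply Hphi. lra.
    - intros x Hx. rewrite Rmin_left, Rmax_right in Hx by lra.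
      apply continuity_pt_filterlim. apply (is_derive_continuous _ _ (dphi x)), Hphi. lra.
    - rewrite Rmin_left, Rmax_right in Hc by lra.
      assert (H1 := Hneg c ltac:(lra)). nra. }
  unfold phi in Hle. rewrite !HN, !Rmult_0_r, exp_0 in Hle.
  set (D := Cmod (delta t)) in *. set (D0 := Cmod (delta 0%R)) in *.
  assert (HD : (0 <= D)%R) by apply Cmod_ge_0.
  assert (HD0 : (0 <= D0)%R) by apply Cmod_ge_0.
  assert (H1 : (D ^ 2 * exp (- L * t) <= (D0 + eps) ^ 2)%R).
  { assert (H2 := pow2_ge_0 eps). nra. }
  assert (HL : (1 <= exp L)%R).
  { rewrite <- exp_0. apply Rlt_le, exp_increasing. unfold L. lra. }
  assert (H2 : (D ^ 2 <= (exp L * (D0 + eps)) ^ 2)%R).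
  { assert (E : (D ^ 2 = D ^ 2 * exp (- L * t) * exp (L * t))%R).
    { rewrite Rmult_assoc, <- exp_plus. replace (- L * t + L * t)%R with 0%R by ring.
      rewrite exp_0. ring. }
    rewrite E, Rpow_mult_distr.
    assert (H3 : (exp (L * t) <= exp L ^ 2)%R).
    { apply Rle_trans with (exp L).
      - destruct (Req_dec (L * t) L) as [->|Hne]; [lra|].
        apply Rlt_le, exp_increasing. unfold L in *. nra.
      - nra. }
    rewrite (Rmult_comm (exp L ^ 2)).
    apply Rmult_le_compat; auto.
    - apply Rmult_le_pos; [apply pow2_ge_0 | apply Rlt_le, exp_pos].
    - apply Rlt_le, exp_pos. }
  apply Rsqr_incr_0_var; [unfold Rsqr; cbn [pow] in H2; lra|].
  apply Rmult_le_pos; lra.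
Qed.

Lemma cderiv_unique (f g : R -> C) (l : R -> C) :
  (forall t, (0 <= t <= 1 / 2)%R -> cderiv f t (l t) /\ cderiv g t (l t)) ->
  f 0%R = g 0%R -> forall t, (0 <= t <= 1 / 2)%R -> f t = g t.
Proof.
  intros H H0 t Ht. apply Ceq_minus, Cmod_eq_0, Rle_antisym; [|apply Cmod_ge_0].
  assert (G := gronwall 0 0 (fun s => f s - g s) (fun _ => 0) (fun _ => 0) ltac:(lra) ltac:(lra)).
  cbv beta in G. rewrite H0 in G. replace (g 0%R - g 0%R) with (RtoC 0) in G by ring.
  rewrite Cmod_0 in G.
  eapply Rle_trans; [apply G|].
  - intros s Hs. split; [|lra]. destruct (H s Hs) as [H1 H2].
    refine (cderiv_eq _ _ _ _ _ (cderiv_minus _ _ _ _ _ H1 H2)). ring.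
  - exact Ht.
  - lra.
Qed.

Definition differentiable (f : R -> C) : Prop := forall t, exists l, cderiv f t l.

Definition cprimitive (c : C) (g : R -> C) (t : R) : C :=
  c + (RInt (fun s => Re (g s)) 0 t, RInt (fun s => Im (g s)) 0 t).

Lemma cprimitive_0 (c : C) (g : R -> C) : cprimitive c g 0 = c.
Proof. unfold cprimitive. rewrite !RInt_point. apply Cplus_0_r. Qed.

Lemma is_derive_RInt_0 (g : R -> R) (t : R) :
  (forall s, continuous g s) -> is_derive (fun x => RInt g 0 x) t (g t).
Proof.
  intros H. apply (is_derive_RInt g _ 0); [|apply H].
  apply filter_forall. intros x. apply (RInt_correct g).
  apply (ex_RInt_continuous g). intros; apply H.
Qed.

Lemma cprimitive_deriv (c : C) (g : R -> C) t :
  differentiable g -> cderiv (cprimitive c g) t (g t).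
Proof.
  intros H. unfold cprimitive.
  refine (cderiv_eq _ _ _ _ _ (cderiv_plus _ _ _ _ (g t) (cderiv_const c t) _)); [ring|].
  split; apply is_derive_RInt_0; intros s; destruct (H s) as [l [H1 H2]];
    eapply is_derive_continuous; eauto.
Qed.

Lemma differentiable_mult (f g : R -> C) :
  differentiable f -> differentiable g -> differentiable (fun t => f t * g t).
Proof.
  intros Hf Hg t. destruct (Hf t) as [l Hl], (Hg t) as [m Hm].
  eexists. apply cderiv_mult; eauto.
Qed.

Lemma differentiable_csum (f : nat -> R -> C) N :
  (forall n, (n <= N)%nat -> differentiable (f n)) ->
  differentiable (fun t => csum (fun n => f n t) N).
Proof.
  induction N as [|N IH]; intros H t.
  - destruct (H O (le_n _) t) as [l Hl]. exists l.
    refine (eq_ind _ (fun g => cderiv g t l) Hl _ _).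
    apply functional_extensionality. intros s. now rewrite csum_O.
  - destruct (H (S N) (le_n _) t) as [l Hl].
    destruct (IH (fun n Hn => H n (le_S _ _ Hn)) t) as [m Hm]. exists (m + l).
    refine (eq_ind _ (fun g => cderiv g t (m + l)) (cderiv_plus _ _ _ _ _ Hm Hl) _ _).
    apply functional_extensionality. intros s. now rewrite csum_S.
Qed.

Lemma differentiable_fps_mul (u v : nat -> R -> C) n :
  (forall i, differentiable (u i)) -> (forall i, differentiable (v i)) ->
  differentiable (fun t => fps_mul (fun i => u i t) (fun i => v i t) n).
Proof.
  intros Hu Hv. apply (differentiable_csum (fun i t => u i t * v (n - i)%nat t)).
  intros i _. now apply differentiable_mult.
Qed.

(** * Majorants *)

Definition rconv (a b : nat -> R) (n : nat) : R := rsum (fun i => a i * b (n - i)%nat)%R n.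

Lemma rpsum_le (a b : nat -> R) N r :
  (0 <= r)%R -> (forall n, (n <= N)%nat -> (a n <= b n)%R) -> (rpsum a N r <= rpsum b N r)%R.
Proof.
  intros Hr H. apply rsum_le. intros i Hi. apply Rmult_le_compat_r; [now apply pow_le | auto].
Qed.

(** The triangle [i + j <= N] is contained in the square [i, j <= N]. *)
Lemma rpsum_rconv (a b : nat -> R) N r :
  (0 <= r)%R -> (forall n, (0 <= a n)%R) -> (forall n, (0 <= b n)%R) ->
  (rpsum (rconv a b) N r <= rpsum a N r * rpsum b N r)%R.
Proof.
  intros Hr Ha Hb.
  assert (Hpos : forall (u : nat -> R) i, (forall n, (0 <= u n)%R) -> (0 <= u i * r ^ i)%R).
  { intros u i Hu. apply Rmult_le_pos; [auto | now apply pow_le]. }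
  assert (E : rpsum (rconv a b) N r
              = rsum (fun i => rsum (fun j => a i * r ^ i * (b j * r ^ j))%R (N - i)) N).
  { rewrite <- (rsum_triangle (fun i j => a i * r ^ i * (b j * r ^ j))%R).
    unfold rpsum. apply rsum_ext. intros n Hn.
    fold (rsum (fun i => a i * r ^ i * (b (n - i)%nat * r ^ (n - i)))%R n).
    unfold rconv. rewrite Rmult_comm, <- rsum_scal. apply rsum_ext. intros i Hi.
    replace (r ^ n)%R with (r ^ i * r ^ (n - i))%R; [ring|].
    rewrite <- pow_add. f_equal. lia. }
  rewrite E.
  apply Rle_trans with (rsum (fun i => rpsum b N r * (a i * r ^ i))%R N).
  - apply rsum_le. intros i Hi. rewrite rsum_scal, Rmult_comm.
    apply Rmult_le_compat_r; [now apply Hpos|].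
    apply (rsum_mono (fun j => b j * r ^ j)%R); [lia|]. intros; now apply Hpos.
  - rewrite rsum_scal. fold (rpsum a N r). lra.
Qed.

Lemma Cmod_fps_mul u v n : (Cmod (fps_mul u v n) <= rconv (cabs u) (cabs v) n)%R.
Proof.
  rewrite fps_mulE. eapply Rle_trans; [apply Cmod_csum|]. apply rsum_le.
  intros i _. rewrite Cmod_mult. apply Rle_refl.
Qed.

Lemma rpsum_fps_mul u v N r :
  (0 <= r)%R ->
  (rpsum (cabs (fps_mul u v)) N r <= rpsum (cabs u) N r * rpsum (cabs v) N r)%R.
Proof.
  intros Hr. eapply Rle_trans.
  - apply rpsum_le; [exact Hr|]. intros n _. apply Cmod_fps_mul.
  - apply rpsum_rconv; [exact Hr| |]; intros; apply Cmod_ge_0.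
Qed.

Lemma rconv_le (a b a' b' : nat -> R) n :
  (forall i, (i <= n)%nat -> (0 <= a i <= a' i)%R) ->
  (forall i, (i <= n)%nat -> (0 <= b i <= b' i)%R) ->
  (rconv a b n <= rconv a' b' n)%R.
Proof.
  intros Ha Hb. apply rsum_le. intros i Hi.
  destruct (Ha i Hi), (Hb (n - i)%nat ltac:(lia)). apply Rmult_le_compat; auto.
Qed.

Lemma rconv_nonneg (a b : nat -> R) n :
  (forall i, (0 <= a i)%R) -> (forall i, (0 <= b i)%R) -> (0 <= rconv a b n)%R.
Proof. intros Ha Hb. apply rsum_nonneg. intros. now apply Rmult_le_pos. Qed.

(** * The coefficients of the flow of the model field *)

Definition prefix {T : Type} (d : T) (n : nat) (u : nat -> T) (m : nat) : T :=
  if (m <? n)%nat then u m else d.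

(** Triangular systems of differential equations for the coefficients of a
    power series are solved by successive integration. *)
Lemma triangular_ode (init : nat -> C) (Phi : R -> (nat -> C) -> nat -> C) :
  (forall t u n, u O = init O -> Phi t u (S n) = Phi t (prefix (RtoC 0) (S n) u) (S n)) ->
  (forall t u, u O = init O -> Phi t u O = 0) ->
  (forall (u : nat -> R -> C) n, (forall i, differentiable (u i)) ->
     differentiable (fun t => Phi t (fun i => u i t) n)) ->
  exists u : nat -> R -> C,
    (forall t, u O t = init O) /\ (forall n, u n 0%R = init n)
    /\ forall n t, cderiv (u n) t (Phi t (fun i => u i t) n).
Proof.
  intros Hcausal H0 Hsmooth.
  destruct (strong_recursion (fun _ : R => RtoC 0) (fun n (u : nat -> R -> C) =>
     match n with
     | O => fun _ => init O
     | S _ => cprimitive (init n) (fun t => Phi t (fun i => u i t) n)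
     end)) as [u Hu].
  assert (Hu0 : u O = fun _ => init O) by apply Hu.
  assert (HuS : forall n, u (S n) = cprimitive (init (S n))
            (fun t => Phi t (fun i => prefix (fun _ => RtoC 0) (S n) u i t) (S n))).
  { intros n. apply Hu. }
  assert (Hd : forall n, differentiable (u n)).
  { induction n as [n IH] using lt_wf_ind. destruct n as [|n].
    - rewrite Hu0. intros t. exists 0. apply cderiv_const.
    - rewrite HuS. intros t. eexists. apply cprimitive_deriv. apply Hsmooth.
      intros i. unfold prefix. destruct (Nat.ltb_spec i (S n)) as [Hi|Hi].
      + now apply IH.
      + intros s. exists 0. apply cderiv_const. }
  exists u. split; [now rewrite Hu0|]. split.
  - intros [|n]; [now rewrite Hu0 | rewrite HuS; apply cprimitive_0].
  - intros [|n] t.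
    + rewrite H0 by now rewrite Hu0. rewrite Hu0. apply cderiv_const.
    + assert (E : Phi t (fun i => prefix (fun _ => RtoC 0) (S n) u i t) (S n)
                  = Phi t (fun i => u i t) (S n)).
      { rewrite (Hcausal t (fun i => u i t)) by now rewrite Hu0. f_equal.
        apply functional_extensionality. intros i. unfold prefix.
        now destruct (i <? S n)%nat. }
      rewrite <- E. rewrite HuS at 1.
      apply (cprimitive_deriv _ (fun t => Phi t (fun i => prefix (fun _ => RtoC 0) (S n) u i t) (S n))).
      apply Hsmooth. intros i. unfold prefix. destruct (i <? S n)%nat; [apply Hd|].
      intros s. exists 0. apply cderiv_const.
Qed.

Lemma fps_mul_prefix_lr u v n :
  u O = 0 -> v O = 0 -> fps_mul u v n = fps_mul (prefix (RtoC 0) n u) (prefix (RtoC 0) n v) n.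
Proof.
  intros Hu Hv. rewrite !fps_mulE. apply csum_ext. intros i Hi. unfold prefix.
  destruct (Nat.ltb_spec i n) as [H1|H1], (Nat.ltb_spec (n - i) n) as [H2|H2]; auto.
  - replace i with O by lia. rewrite Hu. ring.
  - replace (n - i)%nat with O by lia. rewrite Hv. ring.
  - replace i with O by lia. rewrite Hu. ring.
Qed.

Lemma fps_mul_ext u v u' v' n :
  (forall i, (i <= n)%nat -> u i = u' i) -> (forall i, (i <= n)%nat -> v i = v' i) ->
  fps_mul u v n = fps_mul u' v' n.
Proof.
  intros Hu Hv. rewrite !fps_mulE. apply csum_ext. intros i Hi.
  now rewrite Hu, Hv by lia.
Qed.

Section Model.

Variables (k : nat) (b : C).

(** The series of [k (u^2 - b u^3)]. *)
Definition field_series (u : nat -> C) (n : nat) : C :=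
  RtoC (INR k) * (fps_mul u u n - b * fps_mul u (fps_mul u u) n).

(** The series of [w / (1 + b w)]. *)
Definition y_init (n : nat) : C := match n with O => 0 | S m => (- b) ^ m end.

Definition x_init (n : nat) : C := match n with O => 1 | S _ => 0 end.

(** As [u] has no constant term, the degree [n] part of [u^2] and [u^3] involves
    only coefficients of degree less than [n]. *)
Lemma field_series_prefix u n :
  u O = 0 -> field_series u n = field_series (prefix (RtoC 0) n u) n.
Proof.
  intros Hu. unfold field_series.
  assert (Hq : fps_mul u u 0 = 0) by (rewrite fps_mulE, csum_O, Hu; ring).
  assert (E : fps_mul u (fps_mul u u) n
              = fps_mul (prefix (RtoC 0) n u)
                  (fps_mul (prefix (RtoC 0) n u) (prefix (RtoC 0) n u)) n).
  { rewrite (fps_mul_prefix_lr u) by assumption. rewrite !fps_mulE.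
    apply csum_ext. intros i Hi. unfold prefix at 2.
    destruct (Nat.ltb_spec (n - i) n) as [H|H].
    - f_equal. apply fps_mul_ext; intros j Hj; unfold prefix;
        now rewrite (proj2 (Nat.ltb_lt j n)) by lia.
    - replace (prefix (RtoC 0) n u i) with (RtoC 0); [ring|].
      unfold prefix. destruct (Nat.ltb_spec i n); [|reflexivity].
      now replace i with O by lia. }
  now rewrite E, (fps_mul_prefix_lr u u) by assumption.
Qed.

Lemma model_y :
  exists y : nat -> R -> C,
    (forall t, y O t = 0) /\ (forall n, y n 0%R = y_init n)
    /\ forall n t, cderiv (y n) t (field_series (fun i => y i t) n).
Proof.
  apply (triangular_ode y_init (fun _ u => field_series u)).
  - intros _ u n Hu. now apply field_series_prefix.
  - intros _ u Hu. rewrite field_series_prefix by exact Hu.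
    unfold field_series. rewrite !fps_mulE, !csum_O. cbn. ring.
  - intros u n Hu t. unfold field_series.
    destruct (differentiable_fps_mul u u n Hu Hu t) as [l Hl].
    destruct (differentiable_fps_mul u (fun i s => fps_mul (fun j => u j s) (fun j => u j s) i) n
                Hu) with (t := t) as [m Hm].
    { intros i. now apply differentiable_fps_mul. }
    eexists. apply cderiv_scal, cderiv_minus; [exact Hl|].
    apply cderiv_scal. exact Hm.
Qed.

Lemma model_x (y : nat -> R -> C) :
  (forall t, y O t = 0) -> (forall i, differentiable (y i)) ->
  exists x : nat -> R -> C,
    (forall t, x O t = 1) /\ (forall n, x n 0%R = x_init n)
    /\ forall n t, cderiv (x n) t (fps_mul (fun i => x i t) (fun i => y i t) n).
Proof.
  intros Hy0 Hy.
  apply (triangular_ode x_init (fun t u => fps_mul u (fun i => y i t))).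
  - intros t u n Hu. rewrite !fps_mulE. apply csum_ext. intros i Hi. unfold prefix.
    destruct (Nat.ltb_spec i (S n)) as [H|H]; [reflexivity|].
    replace (S n - i)%nat with O by lia. rewrite Hy0. ring.
  - intros t u Hu. rewrite fps_mulE, csum_O, Hy0. ring.
  - intros u n Hu. now apply differentiable_fps_mul.
Qed.

Definition y_majorant_step (n : nat) (B : nat -> R) : R :=
  match n with
  | O => 0
  | S m => 3 * (Cmod b ^ m + INR k * (rconv B B n + Cmod b * rconv B (rconv B B) n))
  end%R.

Lemma Cmod_field_series u (B : nat -> R) n :
  (forall i, (i <= n)%nat -> (Cmod (u i) <= B i)%R) ->
  (Cmod (field_series u n) <= INR k * (rconv B B n + Cmod b * rconv B (rconv B B) n))%R.
Proof.
  intros H. unfold field_series.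
  assert (Hq : forall m, (m <= n)%nat -> (Cmod (fps_mul u u m) <= rconv B B m)%R).
  { intros m Hm. eapply Rle_trans; [apply Cmod_fps_mul|].
    apply rconv_le; intros i Hi; (split; [apply Cmod_ge_0 | apply H; lia]). }
  rewrite Cmod_mult, Cmod_R, Rabs_right by (apply Rle_ge, pos_INR).
  apply Rmult_le_compat_l; [apply pos_INR|].
  unfold Cminus. eapply Rle_trans; [apply Cmod_triangle|]. rewrite Cmod_opp, Cmod_mult.
  apply Rplus_le_compat; [now apply Hq|].
  apply Rmult_le_compat_l; [apply Cmod_ge_0|].
  eapply Rle_trans; [apply Cmod_fps_mul|].
  apply rconv_le; intros i Hi; (split; [apply Cmod_ge_0|]); [now apply H | now apply Hq].
Qed.

(** Gronwall's inequality without the linear term; the constant [3] is an upper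
    bound of [exp 1]. *)
Lemma integral_bound (f e : R -> C) (eps : R) :
  (0 <= eps)%R ->
  (forall t, (0 <= t <= 1 / 2)%R -> cderiv f t (e t) /\ (Cmod (e t) <= eps)%R) ->
  forall t, (0 <= t <= 1 / 2)%R -> (Cmod (f t) <= 3 * (Cmod (f 0%R) + eps))%R.
Proof.
  intros Heps H t Ht.
  assert (G := gronwall 0 eps f (fun _ => 0) e ltac:(lra) Heps).
  eapply Rle_trans; [apply G; [|exact Ht]|].
  - intros s Hs. destruct (H s Hs) as [H1 H2]. split; [|split].
    + refine (cderiv_eq _ _ _ _ _ H1). ring.
    + rewrite Cmod_0. lra.
    + exact H2.
  - apply Rmult_le_compat_r.
    + assert (H1 := Cmod_ge_0 (f 0%R)). lra.
    + replace (2 * 0 + 1)%R with 1%R by ring. exact exp_le_3.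
Qed.

Lemma prefix_nonneg (B : nat -> R) n i :
  (forall j, (0 <= B j)%R) -> (0 <= prefix 0%R n B i)%R.
Proof. intros H. unfold prefix. destruct (i <? n)%nat; [apply H | lra]. Qed.

Lemma prefix_le (B : nat -> R) n m i :
  (forall j, (0 <= B j)%R) -> (n <= m)%nat ->
  (prefix 0%R n B i <= prefix 0%R m B i)%R.
Proof.
  intros H Hnm. unfold prefix. destruct (Nat.ltb_spec i n), (Nat.ltb_spec i m);
    try lia; [lra | apply H | lra].
Qed.

Lemma rpsum_prefix (B : nat -> R) n r :
  rpsum (prefix 0%R (S n) B) (S n) r = rpsum B n r.
Proof.
  rewrite rpsum_S. unfold prefix at 2. rewrite Nat.ltb_irrefl.
  rewrite Rmult_0_l, Rplus_0_r. unfold rpsum. apply rsum_ext. intros i Hi.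
  unfold prefix. now rewrite (proj2 (Nat.ltb_lt i (S n))) by lia.
Qed.

Lemma geometric_bound (q r : R) N :
  (0 <= q)%R -> (0 <= r)%R -> (q * r <= 1 / 2)%R ->
  (rpsum (fun n => match n with O => 0 | S m => q ^ m end) N r <= 2 * r)%R.
Proof.
  intros Hq Hr Hqr.
  assert (H : (rpsum (fun n => match n with O => 0 | S m => q ^ m end) N r
               <= 2 * r - 2 * r * (1 / 2) ^ N)%R).
  { induction N as [|N IH]; [rewrite rpsum_O; cbn [pow]; lra|].
    rewrite rpsum_S.
    assert (H1 : (q ^ N * r ^ S N <= r * (1 / 2) ^ N)%R).
    { cbn [pow]. replace (q ^ N * (r * r ^ N))%R with (r * (q * r) ^ N)%R
        by (rewrite Rpow_mult_distr; ring).
      apply Rmult_le_compat_l; [exact Hr|]. apply pow_incr. split; [|exact Hqr].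
      now apply Rmult_le_pos. }
    cbn [pow] in *. lra. }
  assert (H1 : (0 <= (1 / 2) ^ N)%R) by (apply pow_le; lra). nra.
Qed.

(** The majorant has partial sums at most [eta] at radius [rho]. Writing [S] for
    such a sum, the recursion gives
    [S' <= 3 (2 rho + k (1 + |b|) S^2)] as soon as [S <= 1], and
    [3 (2 rho + k (1 + |b|) eta^2) = eta] for the values chosen here. *)
Definition eta : R := (1 / (6 * INR k * (1 + Cmod b)))%R.

Definition rho : R := (eta / 12)%R.

Hypothesis Hk : (1 <= k)%nat.

Lemma eta_spec :
  (0 < eta)%R /\ (INR k * (1 + Cmod b) * eta = 1 / 6)%R
  /\ (eta <= 1 / 6)%R /\ (Cmod b * eta <= 1 / 6)%R.
Proof.
  assert (H1 : (1 <= INR k)%R) by (apply (le_INR 1); exact Hk).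
  assert (H2 := Cmod_ge_0 b).
  assert (H3 : (0 < eta)%R).
  { unfold eta. apply Rdiv_lt_0_compat; [lra|]. apply Rmult_lt_0_compat; lra. }
  assert (H4 : (INR k * (1 + Cmod b) * eta = 1 / 6)%R) by (unfold eta; field; lra).
  assert (H5 : (0 <= Cmod b * eta)%R) by (apply Rmult_le_pos; lra).
  assert (H6 : (1 * ((1 + Cmod b) * eta) <= INR k * ((1 + Cmod b) * eta))%R).
  { apply Rmult_le_compat_r; lra. }
  repeat split; auto; lra.
Qed.

(** The majorant [B] solves the same recursion as the coefficients with absolute
    values, uniformly in the time. Its partial sums at radius [rho] stay below
    [eta] by induction: the sum up to degree [N + 1] is bounded in terms of the
    square and the cube of the sum up to degree [N]. *)
Lemma y_bound (y : nat -> R -> C) :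
  (forall t, y O t = 0) -> (forall n, y n 0%R = y_init n) ->
  (forall n t, cderiv (y n) t (field_series (fun i => y i t) n)) ->
  exists B : nat -> R,
    (forall n, (0 <= B n)%R) /\ B O = 0%R /\
    (forall n t, (0 <= t <= 1 / 2)%R -> (Cmod (y n t) <= B n)%R)
    /\ forall N, (rpsum B N rho <= eta)%R.
Proof.
  intros Hy0 Hyi Hy.
  destruct eta_spec as (He0 & He1 & He2 & He3).
  assert (Hr0 : (0 < rho)%R) by (unfold rho; lra).
  destruct (strong_recursion 0%R y_majorant_step) as [B HB].
  fold (prefix 0%R) in HB.
  assert (HB' : forall n, B n = y_majorant_step n (prefix 0%R n B)) by exact HB.
  assert (HBpos : forall n, (0 <= B n)%R).
  { induction n as [n IH] using lt_wf_ind. rewrite HB'. destruct n as [|n]; [cbn; lra|].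
    unfold y_majorant_step.
    assert (Hp : forall i, (0 <= prefix 0%R (S n) B i)%R).
    { intros i. unfold prefix. destruct (Nat.ltb_spec i (S n)); [now apply IH | lra]. }
    assert (H1 := rconv_nonneg _ _ (S n) Hp Hp).
    assert (H2 := rconv_nonneg _ _ (S n) Hp (fun i => rconv_nonneg _ _ i Hp Hp)).
    assert (H3 := pow_le _ n (Cmod_ge_0 b)).
    apply Rmult_le_pos; [lra|]. apply Rplus_le_le_0_compat; [exact H3|].
    apply Rmult_le_pos; [apply pos_INR|]. apply Rplus_le_le_0_compat; [exact H1|].
    apply Rmult_le_pos; [apply Cmod_ge_0 | exact H2]. }
  assert (HB0 : B O = 0%R) by (rewrite HB'; reflexivity).
  exists B. split; [exact HBpos|]. split; [exact HB0|]. split.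
  - induction n as [n IH] using lt_wf_ind. intros t Ht. destruct n as [|n].
    + rewrite Hy0, Cmod_0, HB0. lra.
    + rewrite HB'. unfold y_majorant_step.
      set (P := prefix 0%R (S n) B).
      eapply Rle_trans.
      * apply (integral_bound (y (S n)) (fun t => field_series (fun i => y i t) (S n))
                 (INR k * (rconv P P (S n) + Cmod b * rconv P (rconv P P) (S n)))%R).
        -- assert (Hp : forall i, (0 <= P i)%R) by (intros; now apply prefix_nonneg).
           apply Rmult_le_pos; [apply pos_INR|]. apply Rplus_le_le_0_compat.
           ++ now apply rconv_nonneg.
           ++ apply Rmult_le_pos; [apply Cmod_ge_0|]. apply rconv_nonneg; auto.
              intros; now apply rconv_nonneg.
        -- intros s Hs. split; [apply Hy|].
           rewrite field_series_prefix by apply Hy0. apply Cmod_field_series.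
           intros i Hi. unfold P, prefix. destruct (Nat.ltb_spec i (S n)).
           ++ now apply IH.
           ++ rewrite Cmod_0. lra.
        -- exact Ht.
      * rewrite Hyi. cbn [y_init]. rewrite Cmod_pow, Cmod_opp. lra.
  - assert (HBs : forall N, (0 <= rpsum B N rho)%R).
    { intros N. apply rsum_nonneg. intros i _.
      apply Rmult_le_pos; [apply HBpos | apply pow_le; lra]. }
    induction N as [|N IH].
    + rewrite rpsum_O, HB0. lra.
    + set (P := prefix 0%R (S N) B).
      assert (Hp : forall i, (0 <= P i)%R) by (intros; now apply prefix_nonneg).
      assert (HPP : forall i, (0 <= rconv P P i)%R) by (intros; now apply rconv_nonneg).
      set (g := fun n => match n with O => 0%R | S m => (Cmod b ^ m)%R end).
      assert (H1 : (rpsum B (S N) rho <= rpsum (fun n => 3 * (g n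
                 + INR k * (rconv P P n + Cmod b * rconv P (rconv P P) n)))%R (S N) rho)%R).
      { apply rpsum_le; [lra|]. intros n Hn.
        assert (HQ : forall i, (0 <= prefix 0%R n B i <= P i)%R).
        { intros i. split; [now apply prefix_nonneg | now apply prefix_le]. }
        assert (HQQ : forall i, (0 <= rconv (prefix 0%R n B) (prefix 0%R n B) i <= rconv P P i)%R).
        { intros i. split; [apply rconv_nonneg; intros; apply HQ|].
          apply rconv_le; intros; apply HQ. }
        assert (HQ2 : (rconv (prefix 0%R n B) (rconv (prefix 0%R n B) (prefix 0%R n B)) n
                       <= rconv P (rconv P P) n)%R).
        { apply rconv_le; intros; [apply HQ | apply HQQ]. }
        assert (Hn0 := rconv_nonneg P (rconv P P) n Hp HPP).
        rewrite HB'. unfold y_majorant_step. destruct n as [|n].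
        - cbn [g]. specialize (HPP O). assert (H2 := pos_INR k). assert (H3 := Cmod_ge_0 b).
          assert (H4 : (0 <= INR k * (rconv P P 0 + Cmod b * rconv P (rconv P P) 0))%R).
          { apply Rmult_le_pos; [exact H2|]. apply Rplus_le_le_0_compat; [exact HPP|].
            now apply Rmult_le_pos. }
          lra.
        - cbn [g]. apply Rmult_le_compat_l; [lra|]. apply Rplus_le_compat_l.
          apply Rmult_le_compat_l; [apply pos_INR|]. apply Rplus_le_compat; [apply HQQ|].
          apply Rmult_le_compat_l; [apply Cmod_ge_0 | exact HQ2]. }
      assert (E : rpsum (fun n => 3 * (g n
                 + INR k * (rconv P P n + Cmod b * rconv P (rconv P P) n)))%R (S N) rho
              = (3 * (rpsum g (S N) rho + INR k * (rpsum (rconv P P) (S N) rho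
                   + Cmod b * rpsum (rconv P (rconv P P)) (S N) rho)))%R).
      { unfold rpsum. rewrite <- !rsum_scal, <- !rsum_plus, <- !rsum_scal, <- !rsum_plus,
          <- !rsum_scal.
        apply rsum_ext. intros i _. ring. }
      rewrite E in H1.
      assert (HS : rpsum P (S N) rho = rpsum B N rho) by apply rpsum_prefix.
      assert (H2 := rpsum_rconv P P (S N) rho ltac:(lra) Hp Hp).
      assert (H3 := rpsum_rconv P (rconv P P) (S N) rho ltac:(lra) Hp HPP).
      rewrite HS in H2, H3.
      assert (H4 : (rpsum g (S N) rho <= 2 * rho)%R).
      { apply geometric_bound; [apply Cmod_ge_0 | lra|].
        unfold rho. assert (H5 := Cmod_ge_0 b). nra. }
      set (s := rpsum B N rho) in *. specialize (HBs N). fold s in HBs.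
      set (Q := rpsum (rconv P P) (S N) rho) in *.
      assert (HQ0 : (Q <= eta * eta)%R) by nra.
      assert (HQ0' : (0 <= Q)%R).
      { apply rsum_nonneg. intros i _. apply Rmult_le_pos; [apply HPP | apply pow_le; lra]. }
      assert (HT : (rpsum (rconv P (rconv P P)) (S N) rho <= eta * eta)%R).
      { eapply Rle_trans; [exact H3|]. apply Rle_trans with (1 * Q)%R; [|lra].
        apply Rmult_le_compat_r; lra. }
      set (T := rpsum (rconv P (rconv P P)) (S N) rho) in *.
      assert (H5 : (Q + Cmod b * T <= (1 + Cmod b) * (eta * eta))%R).
      { assert (H6 := Cmod_ge_0 b). nra. }
      assert (H6 : (INR k * (Q + Cmod b * T) <= INR k * ((1 + Cmod b) * (eta * eta)))%R).
      { apply Rmult_le_compat_l; [apply pos_INR | exact H5]. }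
      replace (INR k * ((1 + Cmod b) * (eta * eta)))%R
        with (INR k * (1 + Cmod b) * eta * eta)%R in H6 by ring.
      rewrite He1 in H6. assert (Er : rho = (eta / 12)%R) by reflexivity. lra.
Qed.

(** The equation [x' = x y] is linear, so that the partial sums of a majorant of
    [x] satisfy [S' <= 1 + 3 eta S], with [3 eta <= 1/2]. *)
Lemma x_bound (x y : nat -> R -> C) (B : nat -> R) :
  (forall t, y O t = 0) ->
  (forall t, x O t = 1) -> (forall n, x n 0%R = x_init n) ->
  (forall n t, cderiv (x n) t (fps_mul (fun i => x i t) (fun i => y i t) n)) ->
  (forall n, (0 <= B n)%R) -> B O = 0%R ->
  (forall n t, (0 <= t <= 1 / 2)%R -> (Cmod (y n t) <= B n)%R) ->
  (forall N, (rpsum B N rho <= eta)%R) ->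
  forall N t, (0 <= t <= 1 / 2)%R -> (rpsum (cabs (fun n => x n t)) N rho <= 2)%R.
Proof.
  intros Hy0 Hx0 Hxi Hx HB HB0 Hy HBs.
  destruct eta_spec as (He0 & He1 & He2 & He3).
  assert (Hr0 : (0 < rho)%R) by (unfold rho; lra).
  destruct (strong_recursion 0%R (fun n D =>
     match n with O => 1 | S _ => 3 * rconv D B n end)%R) as [D HD].
  assert (HD' : forall n, D (S n) = (3 * rconv (prefix 0%R (S n) D) B (S n))%R)
    by (intros; apply HD).
  assert (HD0 : D O = 1%R) by apply HD.
  assert (HDpos : forall n, (0 <= D n)%R).
  { induction n as [n IH] using lt_wf_ind. destruct n as [|n]; [rewrite HD0; lra|].
    rewrite HD'. apply Rmult_le_pos; [lra|]. apply rconv_nonneg; [|exact HB].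
    intros i. unfold prefix. destruct (Nat.ltb_spec i (S n)); [now apply IH | lra]. }
  assert (HxD : forall n t, (0 <= t <= 1 / 2)%R -> (Cmod (x n t) <= D n)%R).
  { induction n as [n IH] using lt_wf_ind. intros t Ht. destruct n as [|n].
    - rewrite Hx0, HD0, Cmod_1. lra.
    - rewrite HD'. set (P := prefix 0%R (S n) D).
      assert (He : forall s, (0 <= s <= 1 / 2)%R ->
        (Cmod (fps_mul (fun i => x i s) (fun i => y i s) (S n)) <= rconv P B (S n))%R).
      { intros s Hs. rewrite fps_mulE.
        eapply Rle_trans; [apply Cmod_csum|]. apply rsum_le. intros i Hi.
        rewrite Cmod_mult. unfold P, prefix. destruct (Nat.ltb_spec i (S n)) as [H|H].
        - apply Rmult_le_compat; auto using Cmod_ge_0.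
        - replace (S n - i)%nat with O by lia. rewrite Hy0, Cmod_0, HB0. lra. }
      assert (G := integral_bound (x (S n)) _ _
          (rconv_nonneg P B (S n) (fun i => prefix_nonneg D (S n) i HDpos) HB)
          (fun s Hs => conj (Hx (S n) s) (He s Hs)) t Ht).
      rewrite Hxi in G. cbn [x_init] in G. rewrite Cmod_0, Rplus_0_l in G. exact G. }
  intros N t Ht. apply Rle_trans with (rpsum D N rho).
  { apply rpsum_le; [lra|]. intros; now apply HxD. }
  induction N as [|N IH]; [rewrite rpsum_O, HD0; lra|].
  set (P := prefix 0%R (S N) D).
  assert (Hp : forall i, (0 <= P i)%R) by (intros; now apply prefix_nonneg).
  set (g := fun n => match n with O => 1%R | S _ => 0%R end).
  assert (H1 : (rpsum D (S N) rho <= rpsum (fun n => g n + 3 * rconv P B n)%R (S N) rho)%R).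
  { apply rpsum_le; [lra|]. intros [|n] Hn.
    - rewrite HD0. cbn [g]. assert (H2 := rconv_nonneg P B 0 Hp HB). lra.
    - rewrite HD'. cbn [g].
      assert (H2 : (rconv (prefix 0%R (S n) D) B (S n) <= rconv P B (S n))%R).
      { apply rconv_le; intros; split; auto using Rle_refl, prefix_nonneg.
        now apply prefix_le. }
      lra. }
  assert (E : rpsum (fun n => g n + 3 * rconv P B n)%R (S N) rho
              = (rpsum g (S N) rho + 3 * rpsum (rconv P B) (S N) rho)%R).
  { unfold rpsum. rewrite <- rsum_scal, <- rsum_plus. apply rsum_ext. intros; ring. }
  assert (Eg : forall M, rpsum g M rho = 1%R).
  { induction M as [|M IHM]; [apply rpsum_O|]. rewrite rpsum_S, IHM. cbn [g]. ring. }
  rewrite E, Eg in H1.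
  assert (H2 := rpsum_rconv P B (S N) rho ltac:(lra) Hp HB).
  unfold P in H2 at 2. rewrite rpsum_prefix in H2.
  assert (H3 := HBs (S N)).
  assert (H4 : (0 <= rpsum B (S N) rho)%R).
  { apply rsum_nonneg. intros i _. apply Rmult_le_pos; [apply HB | apply pow_le; lra]. }
  assert (H5 : (0 <= rpsum D N rho)%R).
  { apply rsum_nonneg. intros i _. apply Rmult_le_pos; [apply HDpos | apply pow_le; lra]. }
  nra.
Qed.

End Model.

(** The formal solution of [y' = k (y^2 - b y^3)], [x' = x y] as a power series in
    [w], with [y(0) = w / (1 + b w)] and [x(0) = 1]. The trajectory that starts at
    [z] is then [z x] with [w = z^k]. *)
Definition model_series (k : nat) (b : C) (y x : nat -> R -> C) : Prop :=
  (forall t, y O t = 0) /\ (forall n, y n 0%R = y_init b n)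
  /\ (forall n t, cderiv (y n) t (field_series k b (fun i => y i t) n))
  /\ (forall t, x O t = 1) /\ (forall n, x n 0%R = x_init n)
  /\ (forall n t, cderiv (x n) t (fps_mul (fun i => x i t) (fun i => y i t) n)).

Lemma model_series_exists k (b : C) :
  (1 <= k)%nat ->
  exists y x, model_series k b y x
    /\ forall N t, (0 <= t <= 1 / 2)%R ->
         (rpsum (cabs (fun n => y n t)) N (rho k b) <= eta k b)%R
         /\ (rpsum (cabs (fun n => x n t)) N (rho k b) <= 2)%R.
Proof.
  intros Hk. destruct (model_y k b) as (y & Hy0 & Hyi & Hy).
  destruct (model_x y Hy0) as (x & Hx0 & Hxi & Hx).
  { intros i t. eexists. apply Hy. }
  destruct (y_bound k b Hk y Hy0 Hyi Hy) as (B & HB & HB0 & HyB & HBs).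
  destruct (eta_spec k b Hk) as (He0 & _).
  exists y, x. split; [unfold model_series; auto 10|]. intros N t Ht. split.
  - eapply Rle_trans; [|apply (HBs N)]. apply rpsum_le; [unfold rho; lra|].
    intros n _. now apply HyB.
  - now apply (x_bound k b Hk x y B).
Qed.

(** Summation of the geometric progression. *)
Lemma psum_y_init (b w : C) N :
  psum (y_init b) N w * (1 + b * w) = w - w * (- (b * w)) ^ N.
Proof.
  induction N as [|N IH].
  - rewrite psum_O. cbn. ring.
  - rewrite psum_S, Cmult_plus_distr_r, IH. cbn [y_init].
    replace (- (b * w)) with ((- b) * w) by ring. rewrite !Cpow_mult_l, !Cpow_S. ring.
Qed.

Lemma psum_x_init (w : C) N : psum x_init N w = 1.
Proof.
  induction N as [|N IH]; [apply psum_O|]. rewrite psum_S, IH. cbn [x_init]. ring.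
Qed.

Lemma psum_scal (l : C) a N z : psum (fun n => l * a n) N z = l * psum a N z.
Proof. unfold psum. rewrite <- csum_scal. apply csum_ext; intros; ring. Qed.

Lemma psum_field_series k (b : C) u N (w : C) :
  psum (field_series k b u) N w
  = RtoC (INR k) * (psum (fps_mul u u) N w - b * psum (fps_mul u (fps_mul u u)) N w).
Proof.
  unfold field_series. rewrite psum_scal, psum_minus, psum_scal. reflexivity.
Qed.

(** The defect of a truncated series [A] in the equation [Y' = k (Y^2 - b Y^3)]. *)
Lemma field_series_trunc k (b : C) u N (w : C) (r e : R) :
  (0 <= r)%R -> (Cmod w <= r / 2)%R -> (0 <= e <= 1)%R ->
  (rpsum (cabs u) N r <= e)%R ->
  (Cmod (RtoC (INR k) * (psum u N w ^ 2 - b * psum u N w ^ 3)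
         - psum (field_series k b u) N w)
   <= (1 / 2) ^ N * (INR k * (1 + 2 * Cmod b)))%R.
Proof.
  intros Hr Hw He Hu. rewrite psum_field_series.
  set (A := psum u N w). set (q := fps_mul u u).
  assert (Hu0 := rpsum_nonneg u N r Hr).
  assert (Hq : (rpsum (cabs q) N r <= 1)%R).
  { eapply Rle_trans; [apply rpsum_fps_mul; exact Hr|]. nra. }
  assert (Hq0 := rpsum_nonneg q N r Hr).
  assert (H1 := psum_mul_trunc u u r (1 / 2) w N Hr ltac:(lra) ltac:(lra)).
  assert (H2 := psum_mul_trunc u q r (1 / 2) w N Hr ltac:(lra) ltac:(lra)).
  fold q in H1. fold A in H1, H2.
  assert (Hp : (0 <= (1 / 2) ^ N)%R) by (apply pow_le; lra).
  assert (H1' : (Cmod (A * A - psum q N w) <= (1 / 2) ^ N)%R).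
  { eapply Rle_trans; [exact H1|]. cbn [pow].
    assert (rpsum (cabs u) N r * rpsum (cabs u) N r <= 1)%R by nra. nra. }
  assert (H2' : (Cmod (A * psum q N w - psum (fps_mul u q) N w) <= (1 / 2) ^ N)%R).
  { eapply Rle_trans; [exact H2|]. cbn [pow].
    assert (rpsum (cabs u) N r * rpsum (cabs q) N r <= 1)%R by nra. nra. }
  assert (HA : (Cmod A <= 1)%R).
  { apply Rle_trans with (rpsum (cabs u) N r); [|lra]. apply Cmod_psum_le. lra. }
  replace (RtoC (INR k) * (A ^ 2 - b * A ^ 3)
           - RtoC (INR k) * (psum q N w - b * psum (fps_mul u q) N w))
    with (RtoC (INR k) * ((A * A - psum q N w)
            + - (b * (A * (A * A - psum q N w) + (A * psum q N w - psum (fps_mul u q) N w)))))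
    by (cbn [Cpow]; ring).
  rewrite Cmod_mult, Cmod_R, Rabs_right by (apply Rle_ge, pos_INR).
  replace ((1 / 2) ^ N * (INR k * (1 + 2 * Cmod b)))%R
    with (INR k * ((1 / 2) ^ N + Cmod b * (1 * (1 / 2) ^ N + (1 / 2) ^ N)))%R by ring.
  apply Rmult_le_compat_l; [apply pos_INR|].
  eapply Rle_trans; [apply Cmod_triangle|]. rewrite Cmod_opp, Cmod_mult.
  apply Rplus_le_compat; [exact H1'|]. apply Rmult_le_compat_l; [apply Cmod_ge_0|].
  eapply Rle_trans; [apply Cmod_triangle|]. rewrite Cmod_mult.
  apply Rplus_le_compat; [|exact H2'].
  apply Rmult_le_compat; auto using Cmod_ge_0.
Qed.

Lemma one_plus_lower (z : C) : (Cmod z <= 1 / 2)%R -> (1 / 2 <= Cmod (1 + z))%R.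
Proof.
  intros H. assert (H1 := Cmod_triangle (1 + z) (- z)).
  replace (1 + z + - z) with (RtoC 1) in H1 by ring.
  rewrite Cmod_1, Cmod_opp in H1. lra.
Qed.

(** The difference between [Y] and the truncation [A N] of [y] solves a linear
    equation whose coefficient is bounded along the trajectory and whose
    inhomogeneous term is [O(2^(-N))], because [w] lies within half the
    radius [rho] at which the majorant is bounded. The same argument then compares [gamma]
    with [gamma(0)] times the truncation [X N] of [x]. *)
Lemma flow_estimate k (b : C) (y x : nat -> R -> C) (w : C) (gamma Y : R -> C) :
  (1 <= k)%nat -> model_series k b y x ->
  (forall N t, (0 <= t <= 1 / 2)%R ->
     (rpsum (cabs (fun n => y n t)) N (rho k b) <= eta k b)%R
     /\ (rpsum (cabs (fun n => x n t)) N (rho k b) <= 2)%R) ->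
  (Cmod w <= rho k b / 2)%R ->
  Y 0%R * (1 + b * w) = w ->
  (forall t, (0 <= t <= 1 / 2)%R ->
     cderiv gamma t (gamma t * Y t)
     /\ cderiv Y t (RtoC (INR k) * (Y t ^ 2 - b * Y t ^ 3))) ->
  exists K : R, forall N,
    (Cmod (gamma (1 / 2)%R - gamma 0%R * psum (fun n => x n (1 / 2)%R) N w)
     <= K * (1 / 2) ^ N)%R.
Proof.
  intros Hk (Hy0 & Hyi & Hy & Hx0 & Hxi & Hx) Hbd Hw HY0 Hode.
  destruct (eta_spec k b Hk) as (He0 & _ & He2 & He3).
  assert (Hr : (0 < rho k b)%R) by (unfold rho; lra).
  assert (Er : rho k b = (eta k b / 12)%R) by reflexivity.
  destruct (cderiv_bounded Y (1 / 2)) as (M & HM0 & HM); [lra| |].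
  { intros t Ht. eexists. apply (Hode t Ht). }
  set (A := fun N t => psum (fun n => y n t) N w).
  assert (HA : forall N t, (0 <= t <= 1 / 2)%R -> (Cmod (A N t) <= 1)%R).
  { intros N t Ht. apply Rle_trans with (eta k b); [|lra].
    apply Rle_trans with (2 := proj1 (Hbd N t Ht)). apply Cmod_psum_le. lra. }
  assert (Hbw : (Cmod (- (b * w)) <= 1 / 2)%R).
  { rewrite Cmod_opp, Cmod_mult. assert (H1 := Cmod_ge_0 b).
    apply Rle_trans with (Cmod b * eta k b)%R; [|lra].
    apply Rmult_le_compat_l; lra. }
  assert (Hp : forall N, (0 <= (1 / 2) ^ N)%R) by (intros; apply pow_le; lra).
  assert (Hini : forall N, (Cmod (Y 0%R - A N 0%R) <= (1 / 2) ^ N)%R).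
  { intros N. assert (E : (Y 0%R - A N 0%R) * (1 + b * w) = w * (- (b * w)) ^ N).
    { unfold A. rewrite (psum_ext _ (y_init b)) by (intros; apply Hyi).
      transitivity (Y 0%R * (1 + b * w) - psum (y_init b) N w * (1 + b * w)); [ring|].
      rewrite HY0, psum_y_init. ring. }
    apply (f_equal Cmod) in E. rewrite !Cmod_mult, Cmod_pow in E.
    rewrite Cmod_opp in Hbw. assert (H1 := one_plus_lower _ Hbw).
    rewrite <- Cmod_opp in Hbw.
    assert (H2 : (Cmod (- (b * w)) ^ N <= (1 / 2) ^ N)%R).
    { apply pow_incr. split; [apply Cmod_ge_0 | exact Hbw]. }
    assert (H3 : (Cmod w * Cmod (- (b * w)) ^ N <= 1 / 2 * (1 / 2) ^ N)%R).
    { apply Rmult_le_compat; auto using Cmod_ge_0; [apply pow_le, Cmod_ge_0 | lra]. }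
    assert (H4 := Cmod_ge_0 (Y 0%R - A N 0%R)). nra. }
  set (Ck := (INR k * (1 + 2 * Cmod b))%R).
  assert (HCk : (0 <= Ck)%R).
  { apply Rmult_le_pos; [apply pos_INR|]. assert (H1 := Cmod_ge_0 b). lra. }
  set (MH := (INR k * (M + 1 + Cmod b * (M * M + M + 1)))%R).
  assert (HMH : (0 <= MH)%R).
  { apply Rmult_le_pos; [apply pos_INR|]. assert (H1 := Cmod_ge_0 b). nra. }
  set (K1 := (exp (2 * MH + 1) * (1 + Ck))%R).
  assert (HK1 : (0 <= K1)%R).
  { apply Rmult_le_pos; [apply Rlt_le, exp_pos | lra]. }
  assert (HYA : forall N t, (0 <= t <= 1 / 2)%R ->
                  (Cmod (Y t - A N t) <= K1 * (1 / 2) ^ N)%R).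
  { intros N t Ht.
    set (F := fun s => RtoC (INR k) * (A N s ^ 2 - b * A N s ^ 3)
                       - psum (field_series k b (fun n => y n s)) N w).
    set (H := fun s => RtoC (INR k) * ((Y s + A N s)
                         + - (b * (Y s * Y s + Y s * A N s + A N s * A N s)))).
    eapply Rle_trans.
    - apply (gronwall MH ((1 / 2) ^ N * Ck) (fun s => Y s - A N s) H F HMH); [| |exact Ht].
      + apply Rmult_le_pos; [apply Hp | exact HCk].
      + intros s Hs. split; [|split].
        * refine (cderiv_eq _ _ _ _ _ (cderiv_minus _ _ _ _ _ (proj2 (Hode s Hs))
            (cderiv_psum y s (field_series k b (fun n => y n s)) N w (fun n _ => Hy n s)))).
          unfold H, F. cbn [Cpow]. ring.
        * unfold H. rewrite Cmod_mult, Cmod_R, Rabs_right by (apply Rle_ge, pos_INR).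
          apply Rmult_le_compat_l; [apply pos_INR|].
          assert (HYs := HM s Hs). assert (HAs := HA N s Hs).
          assert (HY0' := Cmod_ge_0 (Y s)). assert (HA0' := Cmod_ge_0 (A N s)).
          eapply Rle_trans; [apply Cmod_triangle|]. rewrite Cmod_opp, Cmod_mult.
          apply Rplus_le_compat.
          -- eapply Rle_trans; [apply Cmod_triangle|]. lra.
          -- apply Rmult_le_compat_l; [apply Cmod_ge_0|].
             eapply Rle_trans; [apply Cmod_triangle|].
             apply Rplus_le_compat; [|rewrite Cmod_mult; nra].
             eapply Rle_trans; [apply Cmod_triangle|]. rewrite !Cmod_mult. nra.
        * unfold F, Ck. apply (field_series_trunc k b _ N w (rho k b) (eta k b)); try lra.
          apply (Hbd N s Hs).
    - unfold K1. rewrite Rmult_assoc. apply Rmult_le_compat_l; [apply Rlt_le, exp_pos|].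
      assert (H1 := Hini N). lra. }
  set (X := fun N t => psum (fun n => x n t) N w).
  set (C2 := (Cmod (gamma 0%R) * (2 * K1 + 2))%R).
  assert (HC2 : (0 <= C2)%R) by (apply Rmult_le_pos; [apply Cmod_ge_0 | lra]).
  exists (exp (2 * M + 1) * C2)%R. intros N.
  set (F := fun s => gamma 0%R * (X N s * (Y s - A N s)
     + (X N s * A N s - psum (fps_mul (fun i => x i s) (fun i => y i s)) N w))).
  eapply Rle_trans.
  - apply (gronwall M ((1 / 2) ^ N * C2) (fun s => gamma s - gamma 0%R * X N s) Y F HM0);
      [| |lra].
    + apply Rmult_le_pos; [apply Hp | exact HC2].
    + intros s Hs. split; [|split].
      * refine (cderiv_eq _ _ _ _ _ (cderiv_minus _ _ _ _ _ (proj1 (Hode s Hs))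
           (cderiv_scal _ _ _ _ (cderiv_psum x s _ N w (fun n _ => Hx n s))))).
        unfold F, X. ring.
      * now apply HM.
      * unfold F, C2. rewrite Cmod_mult.
        replace ((1 / 2) ^ N * (Cmod (gamma 0%R) * (2 * K1 + 2)))%R
          with (Cmod (gamma 0%R) * (2 * (K1 * (1 / 2) ^ N) + 2 * (1 / 2) ^ N))%R by ring.
        apply Rmult_le_compat_l; [apply Cmod_ge_0|].
        eapply Rle_trans; [apply Cmod_triangle|]. apply Rplus_le_compat.
        -- rewrite Cmod_mult. apply Rmult_le_compat; auto using Cmod_ge_0.
           apply Rle_trans with (2 := proj2 (Hbd N s Hs)). apply Cmod_psum_le. lra.
        -- eapply Rle_trans.
           { apply (psum_mul_trunc _ _ (rho k b) (1 / 2)); lra. }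
           destruct (Hbd N s Hs) as [B1 B2].
           assert (B3 := rpsum_nonneg (fun n => y n s) N (rho k b) ltac:(lra)).
           assert (B4 := rpsum_nonneg (fun n => x n s) N (rho k b) ltac:(lra)).
           cbn [pow]. specialize (Hp N).
           assert (B5 : (rpsum (cabs (fun n => x n s)) N (rho k b)
                         * rpsum (cabs (fun n => y n s)) N (rho k b) <= 2 * 1)%R).
           { apply Rmult_le_compat; lra. }
           nra.
  - unfold X. rewrite (psum_ext _ x_init) by (intros; apply Hxi). rewrite psum_x_init.
    replace (gamma 0%R - gamma 0%R * 1) with (RtoC 0) by ring. rewrite Cmod_0.
    apply Req_le. ring.
Qed.

(** * The half-time map of the model field *)

(** The series [z x(z^k)] at time [1/2]. *)
Definition half_time_series (k : nat) (x : nat -> R -> C) (n : nat) : C :=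
  match n with
  | O => 0
  | S m => if (m mod k =? 0)%nat then x (m / k)%nat (1 / 2)%R else 0
  end.

Lemma psum_half_time k (x : nat -> R -> C) m (z : C) :
  (1 <= k)%nat ->
  psum (half_time_series k x) (S m) z
  = z * psum (fun n => x n (1 / 2)%R) (m / k) (z ^ k).
Proof.
  intros Hk. induction m as [|m IH].
  - rewrite psum_S, psum_O, Nat.Div0.div_0_l, psum_O. cbn [half_time_series].
    rewrite Nat.Div0.mod_0_l, Nat.Div0.div_0_l, Nat.eqb_refl. cbn [Cpow]. ring.
  - rewrite psum_S, IH. cbn [half_time_series].
    assert (H1 := Nat.div_mod_eq m k). assert (H2 := Nat.div_mod_eq (S m) k).
    assert (H3 := Nat.mod_upper_bound m k ltac:(lia)).
    assert (H4 := Nat.mod_upper_bound (S m) k ltac:(lia)).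
    destruct (Nat.eqb_spec (S m mod k) 0) as [E|E].
    + assert (Ed : (S m / k = S (m / k))%nat).
      { rewrite E in H2. nia. }
      rewrite Ed, psum_S. rewrite <- Ed.
      replace (z ^ S (S m)) with (z * (z ^ k) ^ (S m / k)%nat); [ring|].
      rewrite <- Cpow_mult_r, <- Cpow_S. f_equal. lia.
    + assert (Ed : (S m / k = m / k)%nat) by nia.
      rewrite Ed. ring.
Qed.

Lemma half_time_rotation k (x : nat -> R -> C) :
  (1 <= k)%nat -> rotation_invariant k (half_time_series k x).
Proof.
  intros Hk l n Hl. destruct n as [|m]; cbn [half_time_series]; [ring|].
  destruct (Nat.eqb_spec (m mod k) 0) as [E|E]; [|ring].
  assert (H := Nat.div_mod_eq m k). rewrite E in H.
  assert (El : l ^ m = 1).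
  { replace m with (k * (m / k))%nat by lia. rewrite Cpow_mult_r, Hl. apply Cpow_1_l. }
  rewrite Cpow_S, El. ring.
Qed.

Lemma fps_mul_conj u v n :
  Cconj (fps_mul u v n) = fps_mul (fps_conj u) (fps_conj v) n.
Proof.
  rewrite !fps_mulE, csum_conj. apply csum_ext. intros i _. apply Cmult_conj.
Qed.

(** For real [b] the complex conjugates of the coefficients solve the same
    equations with the same initial values. *)
Lemma model_series_real k (b : C) (y x : nat -> R -> C) :
  model_series k b y x -> Cconj b = b ->
  forall n t, (0 <= t <= 1 / 2)%R -> Cconj (x n t) = x n t.
Proof.
  intros (Hy0 & Hyi & Hy & Hx0 & Hxi & Hx) Hb.
  assert (Yr : forall n t, (0 <= t <= 1 / 2)%R -> Cconj (y n t) = y n t).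
  { induction n as [n IH] using lt_wf_ind.
    apply (cderiv_unique _ _ (fun t => field_series k b (fun i => y i t) n)).
    - intros t Ht. split; [|apply Hy].
      refine (cderiv_eq _ _ _ _ _ (cderiv_conj _ _ _ (Hy n t))).
      rewrite (field_series_prefix k b (fun i => y i t)) by apply Hy0.
      set (u := prefix (RtoC 0) n (fun i => y i t)).
      assert (Hu : fps_conj u = u).
      { apply functional_extensionality. intros i. unfold u, fps_conj, prefix.
        destruct (Nat.ltb_spec i n); [now apply IH | apply Cconj_RtoC]. }
      unfold field_series.
      rewrite Cmult_conj, Cconj_RtoC, Cminus_conj, Cmult_conj, Hb, !fps_mul_conj, Hu.
      do 3 f_equal. apply fps_mul_ext; [reflexivity|]. intros i _.
      unfold fps_conj. rewrite fps_mul_conj. now rewrite Hu.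
    - rewrite Hyi. destruct n as [|n]; cbn [y_init]; [apply Cconj_RtoC|].
      now rewrite Cpow_conj, Copp_conj, Hb. }
  induction n as [n IH] using lt_wf_ind.
  apply (cderiv_unique _ _ (fun t => fps_mul (fun i => x i t) (fun i => y i t) n)).
  - intros t Ht. split; [|apply Hx].
    refine (cderiv_eq _ _ _ _ _ (cderiv_conj _ _ _ (Hx n t))).
    rewrite fps_mul_conj, !fps_mulE. apply csum_ext. intros i Hi. unfold fps_conj.
    rewrite Yr by exact Ht.
    destruct (Nat.eq_dec i n) as [->|Hne].
    + rewrite Nat.sub_diag, Hy0. ring.
    + now rewrite IH by (auto; lia).
  - rewrite Hxi. destruct n; cbn [x_init]; apply Cconj_RtoC.
Qed.

Lemma cderiv_id t : cderiv (fun s => RtoC s) t 1.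
Proof.
  split; cbn.
  - apply (is_derive_id (K := R_AbsRing)).
  - apply (is_derive_const (K := R_AbsRing) (V := R_NormedModule)).
Qed.

(** Explicitly [y = w + (k t - b) w^2 + ...] and
    [x = 1 + t w + ((k+1) t^2 / 2 - b t) w^2 + ...]. *)
Lemma model_series_low k (b : C) (y x : nat -> R -> C) :
  model_series k b y x ->
  x 1%nat (1 / 2)%R = / 2 /\ x 2%nat (1 / 2)%R = RtoC (INR (k + 1) / 8) - b / 2.
Proof.
  intros (Hy0 & Hyi & Hy & Hx0 & Hxi & Hx).
  assert (Y1 : forall t, (0 <= t <= 1 / 2)%R -> y 1%nat t = 1).
  { apply (cderiv_unique _ _ (fun _ => 0)); [|rewrite Hyi; reflexivity].
    intros t Ht. split; [|apply cderiv_const].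
    refine (cderiv_eq _ _ _ _ _ (Hy 1%nat t)). unfold field_series.
    rewrite !fps_mulE. rewrite !csum_S, !csum_O. cbn [Nat.sub].
    rewrite !fps_mulE, !csum_S, !csum_O, !Hy0. ring. }
  assert (Y2 : forall t, (0 <= t <= 1 / 2)%R -> y 2%nat t = - b + RtoC (INR k) * RtoC t).
  { apply (cderiv_unique _ _ (fun _ => RtoC (INR k))).
    2:{ rewrite Hyi. cbn. ring. }
    intros t Ht. split.
    - refine (cderiv_eq _ _ _ _ _ (Hy 2%nat t)). unfold field_series.
      rewrite !fps_mulE. rewrite !csum_S, !csum_O. cbn [Nat.sub].
      rewrite !fps_mulE, !csum_S, !csum_O, !Hy0. cbn [Nat.sub]. rewrite ?Hy0, !Y1 by exact Ht.
      ring.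
    - refine (cderiv_eq _ _ _ _ _ (cderiv_plus _ _ _ _ _ (cderiv_const (- b) t)
        (cderiv_scal (RtoC (INR k)) _ _ _ (cderiv_id t)))). ring. }
  assert (X1 : forall t, (0 <= t <= 1 / 2)%R -> x 1%nat t = RtoC t).
  { apply (cderiv_unique _ _ (fun _ => 1)); [|rewrite Hxi; reflexivity].
    intros t Ht. split; [|apply cderiv_id].
    refine (cderiv_eq _ _ _ _ _ (Hx 1%nat t)).
    rewrite fps_mulE, csum_S, csum_O. cbn [Nat.sub]. rewrite Hx0, Hy0, Y1 by exact Ht. ring. }
  assert (X2 : forall t, (0 <= t <= 1 / 2)%R ->
            x 2%nat t = - b * RtoC t + RtoC (INR (k + 1) / 2) * (RtoC t * RtoC t)).
  { apply (cderiv_unique _ _ (fun t => - b + RtoC (INR k) * RtoC t + RtoC t)).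
    2:{ rewrite Hxi. cbn [x_init]. ring. }
    intros t Ht. split.
    - refine (cderiv_eq _ _ _ _ _ (Hx 2%nat t)).
      rewrite fps_mulE, !csum_S, csum_O. cbn [Nat.sub].
      rewrite Hx0, Hy0, Y1, Y2, X1 by exact Ht. ring.
    - refine (cderiv_eq _ _ _ _ _ (cderiv_plus _ _ _ _ _
        (cderiv_scal (- b) _ _ _ (cderiv_id t))
        (cderiv_scal (RtoC (INR (k + 1) / 2)) _ _ _
           (cderiv_mult _ _ _ _ _ (cderiv_id t) (cderiv_id t))))).
      rewrite plus_INR, RtoC_div, RtoC_plus by lra. cbn [INR]. field. }
  assert (Hh : (0 <= 1 / 2 <= 1 / 2)%R) by lra.
  rewrite X1, X2 by exact Hh. rewrite !RtoC_div by lra. split; field.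
Qed.

Lemma half_time_map k (b : C) (V : C -> C) :
  (1 <= k)%nat ->
  time_map (model_domain k b) (model_field k b) (1 / 2)%R V ->
  exists v, has_series V v /\ rotation_invariant k v /\ parabolic_form k (/ 2) v
    /\ (forall i, (k + 2 <= i <= 2 * k)%nat -> v i = 0)
    /\ v (2 * k + 1)%nat = RtoC (INR (k + 1) / 8) - b / 2
    /\ (Cconj b = b -> fps_conj v = v).
Proof.
  intros Hk HV. destruct (model_series_exists k b Hk) as (y & x & Hyx & Hbd).
  destruct (eta_spec k b Hk) as (He0 & _ & He2 & _).
  assert (Hr : (0 < rho k b)%R) by (unfold rho; lra).
  destruct (model_series_low k b y x Hyx) as [X1 X2].
  assert (Hx0 : forall t, x O t = 1) by apply Hyx.
  set (v := half_time_series k x).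
  exists v. split; [|split; [|split; [|split; [|split]]]].
  - apply has_series_C. unfold time_map in HV. rewrite locally_near0 in HV.
    assert (Hs : (0 < rho k b / 2)%R) by lra.
    refine (near0_imp _ _ _ (near0_and _ _ HV
              (near0_and _ _ (near0_lt _ Hs) (near0_lt 1 ltac:(lra))))).
    intros z ((gamma & Hg0 & Hg & Hg1) & Hz1 & Hz2) eps Heps.
    set (w := z ^ k).
    assert (Hw : (Cmod w <= rho k b / 2)%R).
    { unfold w. rewrite Cmod_pow. replace k with (S (k - 1)) by lia. cbn [pow].
      assert (H1 := Cmod_ge_0 z).
      assert (H2 : (Cmod z ^ (k - 1) <= 1)%R).
      { rewrite <- (pow1 (k - 1)). apply pow_incr. lra. }
      assert (H3 := pow_le _ (k - 1) H1).
      replace (S (k - 1)) with k by lia. nra. }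
    set (Y := fun t => gamma t ^ k * / (1 + b * gamma t ^ k)).
    assert (Hd : forall t, (0 <= t <= 1 / 2)%R -> 1 + b * gamma t ^ k <> 0)
      by (intros t Ht; apply (Hg t Ht)).
    assert (Hgd : forall t, (0 <= t <= 1 / 2)%R -> cderiv gamma t (gamma t * Y t)).
    { intros t Ht. destruct (Hg t Ht) as [_ H1]. apply is_derive_cderiv in H1.
      refine (cderiv_eq _ _ _ _ _ H1). unfold model_field, Y.
      rewrite Nat.add_1_r, Cpow_S. unfold Cdiv. ring. }
    destruct (flow_estimate k b y x w gamma Y Hk Hyx Hbd Hw) as [K HK].
    { unfold Y. rewrite Hg0. fold w. assert (H1 := Hd 0%R ltac:(lra)).
      rewrite Hg0 in H1. fold w in H1. field. exact H1. }
    { intros t Ht. split; [now apply Hgd|].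
      assert (H1 := cderiv_pow gamma t _ k (Y t) eq_refl (Hgd t Ht)).
      refine (cderiv_eq _ _ _ _ _ (cderiv_mult _ _ _ _ _ H1
        (cderiv_inv (fun s => 1 + b * gamma s ^ k) t _ (Hd t Ht)
          (cderiv_plus _ _ _ _ _ (cderiv_const 1 t) (cderiv_scal b _ _ _ H1))))).
      specialize (Hd t Ht). unfold Y. cbn [Cpow]. field. exact Hd. }
    rewrite Hg0, Hg1 in HK.
    assert (HK0 : (0 <= K)%R).
    { assert (H1 := HK O). cbn [pow] in H1.
      assert (H2 := Cmod_ge_0 (V z - z * psum (fun n => x n (1 / 2)%R) 0 w)). lra. }
    destruct (pow_lt_1_zero (1 / 2)) with (y := (eps / (K + 1))%R) as [N0 HN0].
    { rewrite Rabs_right; lra. }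
    { apply Rdiv_lt_0_compat; lra. }
    exists (S (k * N0)). intros N HN. destruct N as [|m]; [lia|].
    unfold v. rewrite psum_half_time by exact Hk. fold w.
    rewrite <- Cmod_opp.
    replace (- (z * psum (fun n => x n (1 / 2)%R) (m / k) w - V z))
      with (V z - z * psum (fun n => x n (1 / 2)%R) (m / k) w) by ring.
    eapply Rle_lt_trans; [apply HK|].
    assert (Hm : (N0 <= m / k)%nat) by (apply Nat.div_le_lower_bound; lia).
    assert (H1 := HN0 (m / k)%nat Hm).
    assert (H2 : (0 <= (1 / 2) ^ (m / k))%R) by (apply pow_le; lra).
    rewrite Rabs_right in H1 by lra.
    apply Rle_lt_trans with (K * (eps / (K + 1)))%R; [apply Rmult_le_compat_l; lra|].
    apply (Rmult_lt_reg_r (K + 1)); [lra|].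
    replace (K * (eps / (K + 1)) * (K + 1))%R with (K * eps)%R by (field; lra). nra.
  - now apply half_time_rotation.
  - assert (Hmod : forall m, (1 <= m < k)%nat -> (m mod k =? 0)%nat = false).
    { intros m Hm. rewrite Nat.mod_small by lia. apply Nat.eqb_neq. lia. }
    repeat split.
    + unfold v. cbn [half_time_series].
      rewrite Nat.Div0.mod_0_l, Nat.Div0.div_0_l, Nat.eqb_refl. apply Hx0.
    + intros [|m] Hi; [lia|]. unfold v. cbn [half_time_series]. now rewrite Hmod by lia.
    + unfold v. rewrite Nat.add_1_r. cbn [half_time_series].
      rewrite Nat.Div0.mod_same, Nat.div_same, Nat.eqb_refl by lia. exact X1.
  - intros [|m] Hi; [lia|]. unfold v. cbn [half_time_series].
    replace m with (m - k + 1 * k)%nat by lia.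
    rewrite Nat.Div0.mod_add, Nat.mod_small by lia.
    now rewrite (proj2 (Nat.eqb_neq (m - k) 0)) by lia.
  - unfold v. rewrite Nat.add_1_r. cbn [half_time_series].
    rewrite Nat.Div0.mod_mul, Nat.div_mul, Nat.eqb_refl by lia. exact X2.
  - intros Hb. apply functional_extensionality. intros [|m]; unfold v, fps_conj;
      cbn [half_time_series]; [apply Cconj_RtoC|].
    destruct (m mod k =? 0)%nat; [|apply Cconj_RtoC].
    apply (model_series_real k b y x Hyx Hb). lra.
Qed.

(** * From germs to formal series *)

Lemma psum_conj a N z : psum (fps_conj a) N z = Cconj (psum a N (Cconj z)).
Proof.
  unfold psum. rewrite csum_conj. apply csum_ext. intros i _.
  rewrite Cmult_conj, Cpow_conj, Cconj_conj. reflexivity.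
Qed.

Lemma near0_conj P : near0 P -> near0 (fun z => P (Cconj z)).
Proof. intros (r & Hr & H). exists r. split; [exact Hr|]. intros z Hz. apply H. now rewrite Cmod_conj. Qed.

Lemma expands_conj N (g : C -> C) a :
  expands N g a -> expands N (fun z => Cconj (g (Cconj z))) (fps_conj a).
Proof.
  intros (K & HK & H). exists K. split; [exact HK|].
  refine (near0_imp _ _ _ (near0_conj _ H)). intros z Hz. cbv beta in *.
  rewrite psum_conj, <- Cminus_conj, Cmod_conj, <- (Cmod_conj z). exact Hz.
Qed.

Lemma has_series_conj (g : C -> C) a :
  has_series g a -> has_series (fun z => Cconj (g (Cconj z))) (fps_conj a).
Proof.
  rewrite !has_series_C. intros H.
  refine (near0_imp _ _ _ (near0_conj _ H)). intros z Hz eps Heps.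
  destruct (Hz eps Heps) as [N0 HN]. exists N0. intros N HN0.
  rewrite psum_conj, <- Cminus_conj, Cmod_conj. now apply HN.
Qed.

(** The square of [z |-> a (zbar)] is the holomorphic germ [a o abar]. *)
Lemma antiseries_square (f : C -> C) a N :
  has_antiseries f a -> a O = 0 -> expands N (fun z => f (f z)) (fps_comp a (fps_conj a)).
Proof.
  intros Hf Ha. assert (H1 := has_series_expands _ _ N Hf). assert (H2 := expands_conj _ _ _ H1).
  assert (H0 : fps_conj a O = 0) by (unfold fps_conj; rewrite Ha; apply Cconj_RtoC).
  refine (expands_ext _ _ _ _ _ _ _ (expands_comp _ _ _ _ _ H0 H1 H2)); [|reflexivity].
  exists 1%R. split; [lra|]. intros z _. now rewrite !Cconj_conj.
Qed.

Lemma formal_invariant_series k (b : C) (f : C -> C) a :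
  (1 <= k)%nat -> has_antiseries f a -> a O = 0 -> formal_invariant f k b ->
  exists g h : nat -> C,
    parabolic_form k 1 g /\ (forall i, (k + 2 <= i <= 2 * k)%nat -> g i = 0)
    /\ g (2 * k + 1)%nat = RtoC (INR (k + 1) / 2) - b
    /\ h O = 0 /\ h 1%nat <> 0
    /\ fps_comp h (fps_comp a (fps_conj a)) = fps_comp g h.
Proof.
  intros Hk Hf Ha (G & (g & Hg) & Hdom & (H & (h & Hh & h0 & h1) & Heq)).
  set (beta := RtoC (INR (k + 1) / 2) - b) in *.
  set (t := fun n => (if (n =? 1)%nat then 1 else 0) + (if (n =? k + 1)%nat then 1 else 0)
                     + (if (n =? 2 * k + 1)%nat then beta else 0)).
  assert (Et : forall z, psum t (2 * k + 1) z
                = z + z ^ (k + 1)%nat + beta * z ^ (2 * k + 1)%nat).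
  { intros z. unfold psum, t.
    rewrite (csum_ext _ (fun n => (if (n =? 1)%nat then z else 0)
              + (if (n =? k + 1)%nat then z ^ (k + 1)%nat else 0)
              + (if (n =? 2 * k + 1)%nat then beta * z ^ (2 * k + 1)%nat else 0))).
    - now rewrite !csum_plus, !csum_delta by lia.
    - intros n _. destruct (Nat.eqb_spec n 1) as [E1|E1],
        (Nat.eqb_spec n (k + 1)) as [E2|E2], (Nat.eqb_spec n (2 * k + 1)) as [E3|E3];
        try lia;
        first [rewrite E1, Cpow_1_r; ring | rewrite E2; ring | rewrite E3; ring | ring]. }
  assert (Hgt : forall n, (n <= 2 * k + 1)%nat -> g n = t n).
  { apply (expands_unique_little (2 * k + 1) G (psum t (2 * k + 1))).
    - intros eps Heps. specialize (Hdom (mkposreal eps Heps)).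
      rewrite locally_near0 in Hdom. refine (near0_imp _ _ _ Hdom). intros z Hz.
      rewrite Et, <- Cmod_pow. exact Hz.
    - now apply has_series_expands.
    - apply expands_psum. }
  assert (Ht : forall n, n <> 1%nat -> n <> (k + 1)%nat -> n <> (2 * k + 1)%nat -> t n = 0).
  { intros n H1 H2 H3. unfold t. apply Nat.eqb_neq in H1, H2, H3. rewrite H1, H2, H3. ring. }
  exists g, h. split; [|split; [|split; [|split; [exact h0|split; [exact h1|]]]]].
  - repeat split.
    + rewrite Hgt, Ht by lia. reflexivity.
    + rewrite Hgt by lia. unfold t.
      rewrite (proj2 (Nat.eqb_neq 1 (k + 1))), (proj2 (Nat.eqb_neq 1 (2 * k + 1))) by lia.
      cbn [Nat.eqb]. ring.
    + intros i Hi. rewrite Hgt, Ht by lia. reflexivity.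
    + rewrite Hgt by lia. unfold t. rewrite Nat.eqb_refl.
      rewrite (proj2 (Nat.eqb_neq (k + 1) 1)), (proj2 (Nat.eqb_neq (k + 1) (2 * k + 1))) by lia.
      ring.
  - intros i Hi. rewrite Hgt, Ht by lia. reflexivity.
  - rewrite Hgt by lia. unfold t. rewrite Nat.eqb_refl.
    rewrite (proj2 (Nat.eqb_neq (2 * k + 1) 1)), (proj2 (Nat.eqb_neq (2 * k + 1) (k + 1))) by lia.
    ring.
  - apply functional_extensionality. intros n.
    assert (EF := antiseries_square f a n Hf Ha).
    assert (Eh := has_series_expands _ _ n Hh). assert (Eg := has_series_expands _ _ n Hg).
    apply (expands_unique n (fun z => G (H z))); [| |lia].
    + rewrite locally_near0 in Heq.
      refine (expands_ext n _ _ _ _ Heq (fun i _ => eq_refl) _).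
      apply (expands_comp n H (fun z => f (f z))); auto. now rewrite fps_comp_O.
    + apply (expands_comp n G H); auto.
Qed.

Theorem proposition2p0p10 :
  forall (k : nat) (b : C) (V f : C -> C),
    time_map (model_domain k b) (model_field k b) (1 / 2)%R V ->
    antiholomorphic_parabolic f ->
    codimension f k ->
    (Nat.Even k -> positive_type f k) ->
    formal_invariant f k b ->
    formally_conjugate f (fun z => Cconj (V z)).
Proof.
  intros k b V f HV _ Hcod Hpos Hinv.
  assert (HA : exists A, real_form f k A /\ (Nat.Even k -> (0 < A (k + 1)%nat)%R)).
  { destruct (Nat.Even_or_Odd k) as [He|Ho].
    - destruct (Hpos He) as (A & HA & HA0). exists A. auto.
    - destruct Hcod as (A & HA). exists A. split; [exact HA|]. intros He.
      exfalso. exact (Nat.Even_Odd_False k He Ho). }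
  destruct HA as (A & ((a & Hfa & (a0 & _ & h0 & h00 & h01 & E0)) & A0 & A1 & Hk & Ak & Agap) & Aev).
  destruct (formal_invariant_series k b f a Hk Hfa a0 Hinv)
    as (g & h & Hg & Hggap & Hgres & hh0 & hh1 & Eh).
  destruct (half_time_map k b V Hk HV) as (v & HVv & Hrot & Hv & Hvgap & Hvres & Hvr).
  exists a, (fps_conj v). split; [exact Hfa|]. split; [exact (has_series_conj V v HVv)|].
  apply (formal_classification k b (A (k + 1)%nat) a (fun n => RtoC (A n)) g v h0 h); auto.
  - apply functional_extensionality. intros n. apply Cconj_RtoC.
  - repeat split; [now rewrite A0 | now rewrite A1|].
    intros i Hi. now rewrite Agap by lia.
  - apply functional_extensionality. exact E0.
Qed.
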